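(* Let $\Pi^*\subset\mathbb{R}^2$ be the open quadrilateral in the $(s,t)$-plane with vertices $$(\beta^2,0),\quad \Big(\beta^2+\tfrac{\beta^6}{\alpha},\tfrac{\beta^6}{\alpha}\Big),\quad \Big(\beta^2+\tfrac{\beta^6}{\alpha},\tfrac{\beta^4}{\alpha}\Big),\quad \Big(\beta^2,\tfrac{\beta^4}{\alpha}\Big),$$ and for $(s,t)\in\Pi^*$ let $\mathcal{R}(s,t)$ be the four-atom piecewise isometry of the rhombus $R$ defined in the context (with third parameter $u=\beta$). Let $\mathcal{F}(s,t)$ be the dressed subdomain of $\mathcal{R}(s,t)$ on the atom $R_1$. Then for every $(s,t)\in\Pi^*$: (a) The return orbit of $R_1$ under $\mathcal{R}(s,t)$ tiles $R$. Moreover there are three dressed subdomains $\mathcal{F}_1,\mathcal{F}_2,\mathcal{F}_3$ of $\mathcal{F}(s,t)$ on triangles, such that their return orbits under $\mathcal{F}(s,t)$, together with the orbits of seven periodic tiles, tile the domain of $\mathcal{F}(s,t)$. After merging adjacent atoms on which the return map acts by the same isometry, $\mathcal{F}_i$ is similar to the base triangle $\mathcal{B}(\tau_i)$, $i=1,2,3$, with shape parameters $$\tau_1=\omega^6\alpha(s-\beta^2),\qquad \tau_2=\omega^4\alpha t,\qquad \tau_3=\omega^6\alpha(s-\beta^2).$$ (b) $\mathcal{F}_1$ and $\mathcal{F}_3$ are self-similar if and only if $s\in\mathbb{Q}(\sqrt5)$ (with $t$ free), and $\mathcal{F}_2$ is self-similar if and only if $t\in\mathbb{Q}(\sqrt5)$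 (with $s$ free). Hence $\mathcal{R}(s,t)$ is self-similar (that is, all three of $\mathcal{F}_1,\mathcal{F}_2,\mathcal{F}_3$ are self-similar) if and only if $(s,t)\in\Pi^*\cap\mathbb{Q}(\sqrt5)^2$.
   Context: Constants: $\alpha=\sqrt5$, $\omega=(\sqrt5+1)/2$, $\beta=\omega^{-1}=(\sqrt5-1)/2$. Coordinates. Let $\mathbf{u}_m=(\cos\frac{2\pi m}{5},\sin\frac{2\pi m}{5})$, $m=0,\dots,4$. A point $\mathbf{x}$ of the plane is described by the coordinates $(X,Y)=(\mathbf{u}_0\cdot\mathbf{x},\mathbf{u}_1\cdot\mathbf{x})$; then $\mathbf{u}_2\cdot\mathbf{x}=-X+\beta Y$, $\mathbf{u}_3\cdot\mathbf{x}=-\beta X-\beta Y$, $\mathbf{u}_4\cdot\mathbf{x}=\beta X-Y$. $\mathtt{R}_m$ is the counterclockwise rotation by $2\pi m/5$ about the origin; in these coordinates $\mathtt{R}_1(X,Y)=(\beta X-Y,X)$ and $\mathtt{R}_m=\mathtt{R}_1^m$. $\mathtt{T}_{(a,b)}$ is the translation $(X,Y)\mapsto(X+a,Y+b)$. Tiles. $[(m_1,\dots,m_n),(\epsilon_1,\dots,\epsilon_n),(b_1,\dots,b_n)]$ denotes the convex polygon of all $\mathbf{x}$ such that, for each $i$, $\mathbf{u}_{m_i}\cdot\mathbf{x}<b_i$ if $\epsilon_i=1$ and $\mathbf{u}_{m_i}\cdot\mathbf{x}\ge b_i$ if $\epsilon_i=-1$. Dressed domains. A dressed domain is a set $X$ partitioned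 into tiles (atoms) $X_1,\dots,X_N$, with a map $\rho:X\to X$ acting on each $X_k$ by an isometry $\rho_k$ of the form $\mathtt{T}_{\mathbf d}\mathtt{R}_m$. For $Y\subset X$, the dressed subdomain on $Y$ is $Y$ with the first-return map $\rho_Y$ of $\rho$ to $Y$. Two dressed domains, $X$ with map $\rho$ and $X'$ with map $\rho'$, are similar if there is $\mathtt{G}\in\mathfrak{G}$ with $\mathtt{G}(X)=X'$, $\mathtt{G}$ carrying atoms to atoms, and $\rho'=\mathtt{G}\circ\rho\circ\mathtt{G}^{-1}$; here $\mathfrak{G}$ is the group generated by the dihedral symmetry group of the regular pentagon (with axes along the $\mathbf u_m$), translations, and homotheties $\mathbf{x}\mapsto\eta\mathbf{x}$, $\eta>0$. Tilings by orbits. The return orbit of $Y$ is the family of sets $\rho^k(Y_j)$, $0\le k<n_j$, where the $Y_j$ are the pieces of $Y$ with a common itinerary (through the atoms of $X$) up to the first return time $n_j$ to $Y$. A periodic tile is a convex polygon $P\subset X$ such that each of $P,\rho(P),\dots,\rho^{n-1}(P)$ lies in a single atom and $\rho^n(P)=P$ for some $n\ge1$; with $n$ minimal, these sets form its orbit. A family of sets tiles $X$ if they are pairwise disjoint subsets of $X$ whose areas sum to the area of $X$. The rhombus map $\mathcal{R}(s,t)$, with $u=\beta$. The domain is $R=[(0,1,0,1),(-1,-1,1,1),(-t,-s,1-t,1-s)]$, with atoms - $R_1=[(0,1,2,1),(-1,-1,-1,1),(-t,-t,-s,1-s)]$, - $R_2=[(0,1,2,1),(1,1,1,-1),(1-t,1-s,-s,-t)]$,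 - $R_3=[(0,1,2,1),(-1,-1,-1,1),(-t,-s,-1-s+u,-t)]$, - $R_4=[(0,1,2,1),(1,1,1,-1),(1-t,-t,-1-s+u,-s)]$, and isometries $\rho_1=\mathtt{T}_{(0,0)}\mathtt{R}_4$, $\rho_2=\mathtt{T}_{(0,1)}\mathtt{R}_4$, $\rho_3=\mathtt{T}_{(1,1-u)}\mathtt{R}_4$, $\rho_4=\mathtt{T}_{(1,2-u)}\mathtt{R}_4$. The base triangle $\mathcal{B}(\tau)$, $0<\tau<1$ ($\tau$ is the shape parameter). The domain is $B=[(1,0,2),(-1,1,1),(\tau-\omega^2,0,0)]$, with atoms - $B_1=[(0,2,3),(1,1,1),(0,0,\omega-\omega\tau)]$, - $B_2=[(1,4,0,3,2),(-1,1,1,-1,1),(\tau-\omega^2,\omega^2-\omega\tau,0,\omega-\omega\tau,0)]$, - $B_3=[(1,0,4),(-1,1,-1),(\tau-\omega^2,0,\omega^2-\omega\tau)]$, and isometries $\mathtt{T}_{(\omega\tau-\omega,\,-\omega^2+\omega^2\tau)}\mathtt{R}_2$ on $B_1$, $\mathtt{T}_{(0,\,\omega^2\tau-\omega^3)}\mathtt{R}_3$ on $B_2$, $\mathtt{T}_{(\omega\tau-2\omega,\,\omega^2\tau-2\omega^2)}\mathtt{R}_2$ on $B_3$. Renormalization function and self-similarity. Define $r:[0,1]\to[0,1]$ by $r(\tau)=\omega^2\tau$ for $0<\tau<\beta^2$, $r(\tau)=\omega^3(\beta-\tau)$ for $\beta^2<\tau<\beta$, $r(\tau)=\omega^2(1-\tau)$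 for $\beta<\tau<1$, and $r(\tau)=0$ for $\tau\in\{0,\beta^2,\beta,1\}$; $r$ describes how the shape parameter of a base triangle changes under induction on a suitable smaller triangle. $\mathcal{B}(\tau)$, and any dressed domain similar to it after merging adjacent atoms with equal isometry, is self-similar if $\tau$ is eventually periodic under $r$. A dressed domain recursively tiled (up to finitely many periodic tiles) by the return orbits of several dressed subdomains of this kind is self-similar if each of these subdomains is self-similar.
   Formalization: The third shape parameter is taken as τ₃ = ω⁴α(s−β²) instead of the printed ω⁶α(s−β²); with the printed value nine periodic tiles, not seven, would be needed, since r(ω⁴α(s−β²)) = ω⁶α(s−β²) and that renormalization step leaves two more. *)

(* Defs.v *)
From HB Require Import structures.
From Stdlib Require Import Relation_Operators.
From mathcomp Require Import all_boot all_order all_algebra.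
From mathcomp Require Import all_classical all_reals all_analysis.
Set Implicit Arguments. Unset Strict Implicit. Unset Printing Implicit Defensive.
Import Order.TTheory GRing.Theory Num.Theory.
Import numFieldNormedType.Exports.
Local Open Scope classical_set_scope.
Local Open Scope ring_scope.

Section Constants.
Variable R : realType.
Definition alpha : R := Num.sqrt 5.
Definition omega : R := (Num.sqrt 5 + 1) / 2.
Definition beta : R := omega^-1.
End Constants.
Arguments alpha {R}.
Arguments omega {R}.
Arguments beta {R}.

(* A point x of the plane is represented by its coordinates
   (X, Y) = (u_0 . x, u_1 . x), where u_m = (cos (2 pi m / 5), sin (2 pi m / 5)). *)
Notation plane R := (R * R)%type.

Section Plane.
Variable R : realType.
Implicit Types (x d : plane R) (m : nat).

(* The scalar product u_m . x, with m taken modulo 5. *)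
Definition udot m x : R :=
  nth 0 [:: x.1; x.2; - x.1 + beta * x.2; - beta * x.1 - beta * x.2;
            beta * x.1 - x.2] (m %% 5)%N.

Definition rot1 x : plane R := (beta * x.1 - x.2, x.1).
Definition rotR m : plane R -> plane R := iter m rot1.
Definition trans d : plane R -> plane R := fun x => (x.1 + d.1, x.2 + d.2).
Definition TR d m : plane R -> plane R := trans d \o rotR m.

(* The reflection in the axis along u_0; it exchanges u_1 and u_4. *)
Definition refl0 x : plane R := (x.1, beta * x.1 - x.2).

(* The group generated by the dihedral group of the regular pentagon (itself
   generated by rot1 and refl0), the translations and the homotheties. *)
Inductive frakG : (plane R -> plane R) -> Prop :=
| frakG_rot : frakG rot1
| frakG_refl : frakG refl0
| frakG_trans d : frakG (trans d)
| frakG_homothety (eta : R) : 0 < eta -> frakG (fun x => (eta * x.1, eta * x.2))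
| frakG_id : frakG id
| frakG_comp g h : frakG g -> frakG h -> frakG (g \o h)
| frakG_inv g h : frakG g -> cancel g h -> cancel h g -> frakG h.

(* Lebesgue measure in the coordinates (X, Y); Euclidean area is this measure
   times the constant 1 / sin (2 pi / 5), which is irrelevant to the
   equalities between areas in which [area] is used. *)
Definition area (A : set (plane R)) : \bar R :=
  (@lebesgue_measure R \x @lebesgue_measure R)%E A.

(* [(m_1, ..), (eps_1, ..), (b_1, ..)] *)
Definition tile (m : seq nat) (eps : seq int) (b : seq R) : set (plane R) :=
  [set x | forall i, (i < size m)%N ->
     if nth 0 eps i == 1 then udot (nth 0%N m i) x < nth 0 b i
     else nth 0 b i <= udot (nth 0%N m i) x].

Definition polygon_with (n : nat) (A : set (plane R)) : Prop :=
  (exists (m : seq nat) (eps : seq int) (b : seq R),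
     [/\ size m = n, size eps = n, size b = n & A = tile m eps b])
  /\ bounded_set A /\ interior A !=set0.

Definition polygon (A : set (plane R)) : Prop := exists n, polygon_with n A.

Definition triangle (A : set (plane R)) : Prop := polygon_with 3 A.

(* Two polygons are adjacent if they have a common boundary segment. *)
Definition adjacent (A B : set (plane R)) : Prop :=
  exists p q : plane R, p != q /\
    forall l : R, 0 <= l <= 1 -> (closure A `&` closure B) (p + l *: (q - p)).

End Plane.

(* The raw data of a dressed domain. The pieces [cell k] may be empty (as happens
   for the first-return words below, most of which are not realized); the atoms
   are the nonempty ones. [iso k] is the isometry attached to the piece [k]. *)
Record dressed (R : realType) := Dressed {
  dom : set (plane R);
  lab : choiceType;
  cell : lab -> set (plane R);
  iso : lab -> plane R -> plane R;
  rho : plane R -> plane R }.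

Section Dressed.
Variable R : realType.
Implicit Types (D E : dressed R) (Y P : set (plane R)) (x : plane R).

Definition atoms D : set (set (plane R)) :=
  [set A | exists k, A = @cell R D k /\ A !=set0].

Definition dressed_domain D : Prop :=
  [/\ finite_set (atoms D) /\ (forall A, atoms D A -> polygon A),
      \bigcup_(A in atoms D) A = dom D,
      forall A B, atoms D A -> atoms D B -> A `&` B !=set0 -> A = B,
      forall x, dom D x -> dom D (rho D x)
    & forall k : lab D, cell k !=set0 ->
        (exists d m, iso k = TR d m) /\ (forall x, cell k x -> rho D x = iso k x)].

Definition of_pieces (X : set (plane R)) (n : nat)
    (A : 'I_n -> set (plane R)) (f : 'I_n -> plane R -> plane R) : dressed R :=
  {| dom := X; lab := 'I_n; cell := A; iso := f;
     rho := fun x => if [pick k | `[< A k x >]] is Some k then f k x else x |}.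

Definition first_return D Y x (n : nat) : Prop :=
  [/\ (0 < n)%N, Y (iter n (rho D) x)
    & forall k, (0 < k < n)%N -> ~ Y (iter k (rho D) x)].

Fixpoint itinerary D (w : seq (lab D)) x : Prop :=
  if w is k :: w' then cell k x /\ itinerary w' (rho D x) else True.

Fixpoint iso_word D (w : seq (lab D)) : plane R -> plane R :=
  if w is k :: w' then iso_word w' \o iso k else id.

(* The dressed subdomain on Y; its pieces are labelled by the itineraries up to
   the first return time. [rho] is junk (the identity) at points of Y that never
   return, a case excluded by [dressed_domain]. *)
Definition subdomain D Y : dressed R :=
  {| dom := Y; lab := seq (lab D);
     cell := fun w => [set x | [/\ Y x, first_return D Y x (size w) & itinerary w x]];
     iso := @iso_word D;
     rho := fun x => iter (xget 0%N [set n | first_return D Y x n]) (rho D) x |}.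

Definition mergeable D (j k : lab D) : Prop :=
  iso j = iso k /\ adjacent (cell j) (cell k).

Definition merge_atoms D : dressed R :=
  {| dom := dom D; lab := lab D;
     cell := fun k => \bigcup_(j in clos_refl_trans _ (@mergeable D) k) cell j;
     iso := @iso R D; rho := rho D |}.

Definition similar_dressed D E : Prop :=
  exists g, [/\ frakG g, g @` dom D = dom E,
    [set g @` A | A in atoms D] = atoms E
    & forall x, dom D x -> rho E (g x) = g (rho D x)].

Definition periodic_tile D P (n : nat) : Prop :=
  [/\ polygon P, P `<=` dom D,
      forall k, (k < n)%N -> exists A, atoms D A /\ iter k (rho D) @` P `<=` A,
      (0 < n)%N /\ iter n (rho D) @` P = P
    & forall k, (0 < k < n)%N -> iter k (rho D) @` P <> P].

Definition tiles (I : choiceType) (J : set I) (S : I -> set (plane R))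
    (X : set (plane R)) : Prop :=
  [/\ forall i, J i -> S i `<=` X, trivIset J S
    & (\esum_(i in J) area (S i) = area X)%E].

(* The family made of the return orbits of the sets in Ys and of the orbits of
   the periodic tiles in Ps: [inl (i, w, k)] is the index of rho^k (Y_(i, w)),
   where Y_(i, w) is the piece of Y_i with itinerary w and k < size w, and
   [inr (j, k)] that of rho^k (P_j), where k is less than the period of P_j. *)
Definition orbit_index D (Ys Ps : seq (set (plane R))) :
    set (nat * seq (lab D) * nat + nat * nat)%type :=
  [set a | match a with
           | inl (i, w, k) => (i < size Ys)%N /\ (k < size w)%N
           | inr (j, k) => (j < size Ps)%N /\
               exists n, periodic_tile D (nth set0 Ps j) n /\ (k < n)%N
           end].

Definition orbit_member D (Ys Ps : seq (set (plane R)))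
    (a : (nat * seq (lab D) * nat + nat * nat)%type) : set (plane R) :=
  match a with
  | inl (i, w, k) => iter k (rho D) @` @cell R (subdomain D (nth set0 Ys i)) w
  | inr (j, k) => iter k (rho D) @` nth set0 Ps j
  end.

Definition tiled_by_orbits D (Ys Ps : seq (set (plane R))) : Prop :=
  tiles (@orbit_index D Ys Ps) (@orbit_member D Ys Ps) (dom D).

End Dressed.

Section Models.
Variable R : realType.
Implicit Types s t tau : R.

Definition rhombus_dom s t : set (plane R) :=
  tile [:: 0; 1; 0; 1]%N [:: -1; -1; 1; 1] [:: - t; - s; 1 - t; 1 - s].

Definition rhombus_atom s t : seq (set (plane R)) :=
  let u := beta in
  [:: tile [:: 0; 1; 2; 1]%N [:: -1; -1; -1; 1] [:: - t; - t; - s; 1 - s];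
      tile [:: 0; 1; 2; 1]%N [:: 1; 1; 1; -1] [:: 1 - t; 1 - s; - s; - t];
      tile [:: 0; 1; 2; 1]%N [:: -1; -1; -1; 1] [:: - t; - s; -1 - s + u; - t];
      tile [:: 0; 1; 2; 1]%N [:: 1; 1; 1; -1] [:: 1 - t; - t; -1 - s + u; - s]].

Definition rhombus_iso : seq (plane R -> plane R) :=
  let u := beta in
  [:: TR (0, 0) 4; TR (0, 1) 4; TR (1, 1 - u) 4; TR (1, 2 - u) 4].

Definition rhombus s t : dressed R :=
  @of_pieces R (rhombus_dom s t) 4
    (fun k => nth set0 (rhombus_atom s t) k) (fun k => nth id rhombus_iso k).

Definition base_dom tau : set (plane R) :=
  tile [:: 1; 0; 2]%N [:: -1; 1; 1] [:: tau - omega ^+ 2; 0; 0].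

Definition base_atom tau : seq (set (plane R)) :=
  [:: tile [:: 0; 2; 3]%N [:: 1; 1; 1] [:: 0; 0; omega - omega * tau];
      tile [:: 1; 4; 0; 3; 2]%N [:: -1; 1; 1; -1; 1]
        [:: tau - omega ^+ 2; omega ^+ 2 - omega * tau; 0; omega - omega * tau; 0];
      tile [:: 1; 0; 4]%N [:: -1; 1; -1]
        [:: tau - omega ^+ 2; 0; omega ^+ 2 - omega * tau]].

Definition base_iso tau : seq (plane R -> plane R) :=
  [:: TR (omega * tau - omega, - omega ^+ 2 + omega ^+ 2 * tau) 2;
      TR (0, omega ^+ 2 * tau - omega ^+ 3) 3;
      TR (omega * tau - 2 * omega, omega ^+ 2 * tau - 2 * omega ^+ 2) 2].

Definition base_triangle tau : dressed R :=
  @of_pieces R (base_dom tau) 3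
    (fun k => nth set0 (base_atom tau) k) (fun k => nth id (base_iso tau) k).

Definition renorm tau : R :=
  if 0 < tau < beta ^+ 2 then omega ^+ 2 * tau
  else if beta ^+ 2 < tau < beta then omega ^+ 3 * (beta - tau)
  else if beta < tau < 1 then omega ^+ 2 * (1 - tau)
  else 0.

Definition eventually_periodic (f : R -> R) (x : R) : Prop :=
  exists n p, (0 < p)%N /\ iter (n + p) f x = iter n f x.

Definition self_similar (D : dressed R) : Prop :=
  exists tau, [/\ 0 < tau < 1, similar_dressed (merge_atoms D) (base_triangle tau)
                & eventually_periodic renorm tau].

Definition in_Qsqrt5 (x : R) : Prop :=
  exists p q : rat, x = ratr p + ratr q * Num.sqrt 5.

(* The open convex quadrilateral with vertices v1, v2, v3, v4. *)
Definition open_quadrilateral (v1 v2 v3 v4 : plane R) : set (plane R) :=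
  [set p | exists c1 c2 c3 c4 : R,
     [/\ [/\ 0 < c1, 0 < c2, 0 < c3 & 0 < c4], c1 + c2 + c3 + c4 = 1
       & p = c1 *: v1 + c2 *: v2 + c3 *: v3 + c4 *: v4]].

Definition Pi_star : set (plane R) :=
  open_quadrilateral
    (beta ^+ 2, 0)
    (beta ^+ 2 + beta ^+ 6 / alpha, beta ^+ 6 / alpha)
    (beta ^+ 2 + beta ^+ 6 / alpha, beta ^+ 4 / alpha)
    (beta ^+ 2, beta ^+ 4 / alpha).

Definition F_domain s t : dressed R :=
  subdomain (rhombus s t) (nth set0 (rhombus_atom s t) 0).

End Models.

(* Main.v *)
(* The four-atom map, its first-return map to R_1 and the first-return maps to the
   three triangles are piecewise isometries whose pieces are half-open polygons with
   sides orthogonal to u_0, .., u_4 and offsets affine in (s, t) with coefficients in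
   Z[omega]. An affine function is positive on the quadrilateral Pi* as soon as it is
   nonnegative at the four vertices and positive at one of them, and by Farkas' lemma
   in the plane the emptiness of such a polygon follows from a positive relation
   between two or three of its normals. Hence inclusion, disjointness and covering of
   polygons can be decided by computation, uniformly in (s, t); the explicit return
   words, periodic words and polygons then certify part (a), the areas being compared
   through the exactness of the resulting partitions.

   For part (b), renorm expands on the line while its conjugate contracts, because
   omega is a unit of conjugate 1 - omega of modulus beta < 1. So the orbit of a
   point of Q(sqrt 5) stays in a finite set; conversely a periodic point solves an
   affine equation of slope different from 1. That self-similarity does not depend on
   the chosen shape parameter follows by comparing the widths of corresponding tiles
   in the directions u_m. *)
Require Import Defs.
From Stdlib Require Import BinInt Relation_Operators.
From mathcomp Require Import all_boot all_order all_algebra.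
From mathcomp Require Import all_classical all_reals all_analysis.
From mathcomp Require Import measurable_realfun.
From mathcomp Require Import zify ssrZ ring lra.
Set Implicit Arguments. Unset Strict Implicit. Unset Printing Implicit Defensive.
Import Order.TTheory GRing.Theory Num.Theory.
Import numFieldNormedType.Exports.
Local Open Scope classical_set_scope.
Local Open Scope ring_scope.

(** * The ring Z[omega] *)

(** The normalized parameters x = omega^6 alpha (s - beta^2) and y = omega^4 alpha t carry Pi* to
    the quadrilateral 0 < x < 1, beta^2 x < y < 1, whose vertices lie in Z[omega]^2. After
    multiplication by alpha omega^6 every offset has coefficients in Z[omega], so each certificate
    is integer arithmetic.

    A dressed subdomain is labelled by all words, of which only finitely many are realized. [models]
    relates such an object to a finite symbolic system and is stable under first return; it is used
    first for R_1 and then for the three triangles inside R_1.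

    The third shape parameter comes out as beta^2 x = omega^4 alpha (s - beta^2), with exponent 4
    where the English statement has 6. Since 0 < beta^2 x < beta^2, [renorm] sends it to x, the
    shape parameter of the first triangle. *)

Section GoldenRatio.
Variable R : realType.
Local Notation omega := (@omega R).
Local Notation beta := (@beta R).
Local Notation alpha := (@alpha R).

Lemma alpha_sqr : alpha ^+ 2 = 5. Proof. by rewrite sqr_sqrtr. Qed.

Lemma alpha_gt0 : 0 < alpha. Proof. by rewrite sqrtr_gt0. Qed.

Lemma omega_alpha : omega = (alpha + 1) / 2. Proof. by []. Qed.

Lemma alpha_omega : alpha = 2 * omega - 1.
Proof. by rewrite omega_alpha; field. Qed.

Lemma omega_sqr : omega ^+ 2 = omega + 1.
Proof. by have := alpha_sqr; rewrite alpha_omega => h; lra. Qed.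

Lemma omega_gt1 : 1 < omega.
Proof.
have h := omega_sqr; have := alpha_gt0; rewrite alpha_omega => h0.
by rewrite ltNge; apply/negP => h1; nra.
Qed.

Lemma omega_gt0 : 0 < omega. Proof. exact: lt_trans ltr01 omega_gt1. Qed.

Lemma betaE : beta = omega - 1.
Proof.
have h := omega_sqr; have h0 := omega_gt0.
by apply: (mulfI (lt0r_neq0 h0)); rewrite mulfV ?lt0r_neq0//; lra.
Qed.

Lemma omega_lt2 : omega < 2.
Proof. have h := omega_sqr; have h1 := omega_gt1; nra. Qed.

Lemma beta_sqr : beta ^+ 2 = 1 - beta.
Proof. by rewrite betaE; have := omega_sqr; lra. Qed.

Lemma beta_gt0 : 0 < beta. Proof. by rewrite invr_gt0 omega_gt0. Qed.

Lemma beta_lt1 : beta < 1. Proof. by rewrite betaE; have := omega_lt2; lra. Qed.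

End GoldenRatio.

(* The pair (a, b) stands for a + b omega. *)
Notation Zw := (Z * Z)%type.

Definition wadd (x y : Zw) : Zw := (Z.add x.1 y.1, Z.add x.2 y.2).
Definition wopp (x : Zw) : Zw := (Z.opp x.1, Z.opp x.2).
Definition wmul (x y : Zw) : Zw :=
  (Z.add (Z.mul x.1 y.1) (Z.mul x.2 y.2),
   Z.add (Z.add (Z.mul x.1 y.2) (Z.mul x.2 y.1)) (Z.mul x.2 y.2)).

Definition wnorm (a b : Z) : Z :=
  Z.sub (Z.mul a (Z.add a b)) (Z.mul b b).

(* If a > 0 > b, then a + b omega >= 0 iff a / - b >= omega, and omega is the
   positive root of X ^ 2 - X - 1. *)
Definition wge0 (x : Zw) : bool :=
  let: (a, b) := x in
  if Z.leb Z0 a then Z.leb Z0 b || Z.leb Z0 (wnorm a b)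
  else Z.leb Z0 b && Z.leb (wnorm a b) Z0.

Definition wgt0 (x : Zw) : bool :=
  let: (a, b) := x in
  if Z.leb Z0 a then (Z.leb Z0 b && Z.ltb Z0 (Z.add a b)) || Z.ltb Z0 (wnorm a b)
  else Z.leb Z0 b && Z.ltb (wnorm a b) Z0.

Arguments wadd : simpl never.
Arguments wopp : simpl never.
Arguments wmul : simpl never.
Arguments wge0 : simpl never.
Arguments wgt0 : simpl never.

Section EvalZw.
Variable R : realType.
Local Notation omega := (@omega R).

Definition zR (z : Z) : R := (int_of_Z z)%:~R.
Definition wR (x : Zw) : R := zR x.1 + zR x.2 * omega.

Lemma zRD x y : zR (Z.add x y) = zR x + zR y.
Proof. by rewrite /zR (rmorphD int_of_Z) intrD. Qed.

Lemma zRM x y : zR (Z.mul x y) = zR x * zR y.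
Proof. by rewrite /zR (rmorphM int_of_Z) intrM. Qed.

Lemma zRN x : zR (Z.opp x) = - zR x.
Proof. by rewrite /zR (rmorphN int_of_Z) intrN. Qed.

Lemma zRB x y : zR (Z.sub x y) = zR x - zR y.
Proof. by rewrite /Z.sub zRD zRN. Qed.

Lemma zR_ge0 z : Z.leb Z0 z -> 0 <= zR z.
Proof. by move=> h; rewrite /zR ler0z; lia. Qed.

Lemma zR_gt0 z : Z.ltb Z0 z -> 0 < zR z.
Proof. by move=> h; rewrite /zR ltr0z; lia. Qed.

Lemma zR_lt0 z : Z.leb Z0 z = false -> zR z < 0.
Proof. by move=> h; rewrite /zR ltrz0; lia. Qed.

Lemma zR_neg z : Z.ltb z Z0 -> zR z < 0.
Proof. by move=> h; rewrite /zR ltrz0; lia. Qed.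

Lemma zR_le0 z : Z.leb z Z0 -> zR z <= 0.
Proof. by move=> h; rewrite /zR lerz0; lia. Qed.

Lemma wR_add x y : wR (wadd x y) = wR x + wR y.
Proof. by rewrite /wR /wadd /= !zRD; ring. Qed.

Lemma wR_opp x : wR (wopp x) = - wR x.
Proof. by rewrite /wR /wopp /= !zRN; ring. Qed.

Lemma wR_mul x y : wR (wmul x y) = wR x * wR y.
Proof.
rewrite /wR /wmul /= !(zRD, zRM); have h := omega_sqr R.
rewrite (_ : (zR x.1 + _) * (zR y.1 + _) =
   zR x.1 * zR y.1 + (zR x.1 * zR y.2 + zR x.2 * zR y.1) * omega
   + zR x.2 * zR y.2 * omega ^+ 2); first by rewrite h; ring.
by ring.
Qed.

Lemma zR_norm a b :
  zR (wnorm a b) = (zR a + zR b * omega) * (zR a + zR b * (1 - omega)).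
Proof.
rewrite zRB !zRM zRD; have h := omega_sqr R.
rewrite (_ : _ * (zR a + zR b * (1 - omega)) = zR a ^+ 2 + zR a * zR b
   + zR b ^+ 2 * (omega - omega ^+ 2)); last by ring.
by rewrite h; ring.
Qed.

(** The conjugate a + b (1 - omega) is positive if a >= 0 > b and negative if a < 0 <= b, because 1
    - omega < 0. In these cases the sign of the norm therefore gives the sign of a + b omega. *)
Lemma wR_ge0 x : wge0 x -> 0 <= wR x.
Proof.
case: x => a b; rewrite /wge0 /wR /=; have h := omega_gt1 R.
case: ifPn => [/zR_ge0 ha|/negbTE/zR_lt0 ha].
  have [hb _|hb /zR_ge0] := boolP (Z.leb Z0 b); first by have := zR_ge0 hb; nra.
  move/negbTE/zR_lt0: hb => hb; rewrite zR_norm pmulr_lge0//; nra.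
by case/andP => /zR_ge0 hb /zR_le0; rewrite zR_norm nmulr_lle0 //; nra.
Qed.

Lemma wR_gt0 x : wgt0 x -> 0 < wR x.
Proof.
case: x => a b; rewrite /wgt0 /wR /=; have h := omega_gt1 R.
case: ifPn => [/zR_ge0 ha|/negbTE/zR_lt0 ha].
  case/orP => [/andP[/zR_ge0 hb /zR_gt0]|/zR_gt0]; first by rewrite zRD; nra.
  rewrite zR_norm => hn; have [hb|hb] := boolP (Z.leb Z0 b).
    have := zR_ge0 hb => {}hb; rewrite lt0r; apply/andP; split; last by nra.
    by apply: contraTneq hn => ->; rewrite mul0r ltxx.
  move/negbTE/zR_lt0: hb => hb; move: hn; rewrite pmulr_lgt0//; nra.
by case/andP => /zR_ge0 hb /zR_neg; rewrite zR_norm nmulr_llt0 //; nra.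
Qed.

End EvalZw.

(** * Affine functions of the parameters and Farkas certificates *)

(* The triple (a, b, c) stands for (a + b x + c y) / (alpha omega ^ 6), where
   x = omega ^ 6 alpha (s - beta ^ 2) and y = omega ^ 4 alpha t range over the
   quadrilateral 0 < x < 1, beta ^ 2 x < y < 1. *)
Notation aff := (Zw * Zw * Zw)%type.

Definition aadd (f g : aff) : aff :=
  (wadd f.1.1 g.1.1, wadd f.1.2 g.1.2, wadd f.2 g.2).
Definition aopp (f : aff) : aff := (wopp f.1.1, wopp f.1.2, wopp f.2).
Definition ascale (z : Zw) (f : aff) : aff :=
  (wmul z f.1.1, wmul z f.1.2, wmul z f.2).

Definition w0 : Zw := (Z0, Z0).
Definition w1 : Zw := (Zpos 1, Z0).
Definition wom : Zw := (Z0, Zpos 1).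
Definition wbe : Zw := (Zneg 1, Zpos 1).
Definition wbe2 : Zw := (Zpos 2, Zneg 1).
Definition wal : Zw := (Zneg 1, Zpos 2).
Definition wpow (z : Zw) (n : nat) : Zw := iter n (wmul z) w1.
Definition wunit : Zw := wmul wal (wpow wom 6).

Definition a0 : aff := (w0, w0, w0).
Definition acst (z : Zw) : aff := (wmul wunit z, w0, w0).
Definition ax : aff := (w0, wunit, w0).
Definition ay : aff := (w0, w0, wunit).
(** Here s = beta^2 + x / (alpha omega^6); for [a_t], t = omega^2 y / (alpha omega^6). *)
Definition a_s : aff := (wmul wunit wbe2, w1, w0).
Definition a_t : aff := (w0, w0, wpow wom 2).

(* Up to the factor alpha omega ^ 6, the values at the four vertices
   (0, 0), (1, beta ^ 2), (1, 1), (0, 1) of the parameter domain. *)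
Definition averts (f : aff) : seq Zw :=
  let: (a, b, c) := f in
  let ab := wadd a b in
  [:: a; wadd a c; wadd ab c; wadd ab (wmul c wbe2)].

Definition age0 (f : aff) : bool := all wge0 (averts f).
Definition agt0 (f : aff) : bool :=
  let v := averts f in all wge0 v && has wgt0 v.

Definition parameters (R : realType) (x y : R) : Prop :=
  0 < x < 1 /\ beta ^+ 2 * x < y < 1.

Section EvalAff.
Variables (R : realType) (x y : R).
Local Notation omega := (@omega R).
Local Notation beta := (@beta R).
Local Notation alpha := (@alpha R).

Definition ev (f : aff) : R :=
  (wR R f.1.1 + wR R f.1.2 * x + wR R f.2 * y) / (alpha * omega ^+ 6).

Lemma unit_gt0 : 0 < alpha * omega ^+ 6.
Proof. by rewrite mulr_gt0 ?alpha_gt0 ?exprn_gt0 ?omega_gt0. Qed.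

Lemma wR0 : wR R w0 = 0. Proof. by rewrite /wR /zR /= mul0r addr0. Qed.
Lemma wR1 : wR R w1 = 1. Proof. by rewrite /wR /zR /= mul0r addr0. Qed.
Lemma wRom : wR R wom = omega. Proof. by rewrite /wR /zR /= mul1r add0r. Qed.
Lemma wRbe : wR R wbe = beta. Proof. by rewrite betaE /wR /zR /= mul1r addrC. Qed.
Lemma wRbe2 : wR R wbe2 = beta ^+ 2.
Proof. by rewrite beta_sqr betaE /wR (_ : zR R (Zpos 2) = 2)// /zR /=; lra. Qed.
Lemma wRal : wR R wal = alpha.
Proof. by rewrite alpha_omega /wR (_ : zR R (Zpos 2) = 2)// /zR /=; lra. Qed.

Lemma wR_pow z n : wR R (wpow z n) = wR R z ^+ n.
Proof. by elim: n => [|n IH]; rewrite ?wR1 //= wR_mul exprS -IH. Qed.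

Lemma wR_unit : wR R wunit = alpha * omega ^+ 6.
Proof. by rewrite wR_mul wR_pow wRal wRom. Qed.

Lemma ev_add f g : ev (aadd f g) = ev f + ev g.
Proof. by rewrite /ev /= !wR_add -mulrDl; congr (_ / _); ring. Qed.

Lemma ev_opp f : ev (aopp f) = - ev f.
Proof. by rewrite /ev /= !wR_opp -mulNr; congr (_ / _); ring. Qed.

Lemma ev_scale z f : ev (ascale z f) = wR R z * ev f.
Proof. by rewrite /ev /= !wR_mul mulrA; congr (_ / _); ring. Qed.

Lemma ev0 : ev a0 = 0.
Proof. by rewrite /ev wR0 !mul0r !addr0 mul0r. Qed.

Lemma ev_cst z : ev (acst z) = wR R z.
Proof.
rewrite /ev /= wR0 !mul0r !addr0 wR_mul wR_unit mulrAC divff ?mul1r//.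
exact: lt0r_neq0 unit_gt0.
Qed.

Lemma ev_x : ev ax = x.
Proof.
by rewrite /ev /= wR0 wR_unit mul0r addr0 add0r mulrAC divff ?mul1r// lt0r_neq0 ?unit_gt0.
Qed.

Lemma ev_y : ev ay = y.
Proof.
by rewrite /ev /= wR0 wR_unit mul0r !add0r mulrAC divff ?mul1r// lt0r_neq0 ?unit_gt0.
Qed.

Lemma bilinear_ge0 (l l' u u' a b c d : R) : 0 < l -> 0 < l' -> 0 < u -> 0 < u' ->
  0 <= a -> 0 <= b -> 0 <= c -> 0 <= d ->
  0 <= l' * (u' * a + u * b) + l * (u' * c + u * d).
Proof. by move=> *; do ![apply: addr_ge0 | apply: mulr_ge0] => //; apply: ltW. Qed.

Lemma bilinear_gt0 (l l' u u' a b c d : R) : 0 < l -> 0 < l' -> 0 < u -> 0 < u' ->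
  0 <= a -> 0 <= b -> 0 <= c -> 0 <= d -> [\/ 0 < a, 0 < b, 0 < c | 0 < d] ->
  0 < l' * (u' * a + u * b) + l * (u' * c + u * d).
Proof.
move=> l0 l'0 u0 u'0 a0 b0 c0 d0 h.
have hab : 0 <= u' * a + u * b by rewrite addr_ge0// mulr_ge0// ltW.
have hcd : 0 <= u' * c + u * d by rewrite addr_ge0// mulr_ge0// ltW.
case: h => h.
- by rewrite ltr_wpDr ?(mulr_ge0 (ltW _))// mulr_gt0// ltr_wpDr ?(mulr_ge0 (ltW _))// mulr_gt0.
- by rewrite ltr_wpDr ?(mulr_ge0 (ltW _))// mulr_gt0// ltr_wpDl ?(mulr_ge0 (ltW _))// mulr_gt0.
- by rewrite ltr_wpDl ?(mulr_ge0 (ltW _))// mulr_gt0// ltr_wpDr ?(mulr_ge0 (ltW _))// mulr_gt0.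
- by rewrite ltr_wpDl ?(mulr_ge0 (ltW _))// mulr_gt0// ltr_wpDl ?(mulr_ge0 (ltW _))// mulr_gt0.
Qed.

Section Positivity.
Hypothesis hxy : parameters x y.

(* y = (1 - l) beta ^ 2 x + l for some 0 < l < 1. *)
Lemma ev_bilinear f : exists2 l, 0 < l < 1 &
  ev f * (alpha * omega ^+ 6) =
  (1 - l) * ((1 - x) * wR R f.1.1 + x * (wR R f.1.1 + wR R f.1.2 + wR R f.2 * beta ^+ 2))
  + l * ((1 - x) * (wR R f.1.1 + wR R f.2) + x * (wR R f.1.1 + wR R f.1.2 + wR R f.2)).
Proof.
have [/andP[x0 x1] /andP[y0 y1]] := hxy.
have d0 : 0 < 1 - beta ^+ 2 * x by rewrite subr_gt0 (lt_trans y0).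
exists ((y - beta ^+ 2 * x) / (1 - beta ^+ 2 * x)).
  apply/andP; split; first by rewrite divr_gt0// subr_gt0.
  by rewrite ltr_pdivrMr// mul1r ltrD2r.
rewrite /ev divfK ?lt0r_neq0 ?unit_gt0//.
set l := _ / _; have hl : l * (1 - beta ^+ 2 * x) = y - beta ^+ 2 * x.
  by rewrite divfK ?lt0r_neq0.
have -> : y = l * (1 - beta ^+ 2 * x) + beta ^+ 2 * x by rewrite hl subrK.
by ring.
Qed.

Lemma age0P f : age0 f -> 0 <= ev f.
Proof.
have [/andP[x0 x1] _] := hxy; have [l /andP[l0 l1] h] := ev_bilinear f.
have {}l1 : 0 < 1 - l by rewrite subr_gt0.
have {}x1 : 0 < 1 - x by rewrite subr_gt0.
rewrite -(pmulr_lge0 _ unit_gt0) h; case: f {h} => [[a b] c]; rewrite /age0 /=.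
have hw := @wR_ge0 R.
case/and5P => /hw h1 /hw h2 /hw h3 /hw h4 _.
move: h1 h2 h3 h4; rewrite !(wR_add, wR_mul) wRbe2 => h1 h2 h3 h4.
exact: bilinear_ge0.
Qed.

Lemma agt0P f : agt0 f -> 0 < ev f.
Proof.
have [/andP[x0 x1] _] := hxy; have [l /andP[l0 l1] h] := ev_bilinear f.
have {}l1 : 0 < 1 - l by rewrite subr_gt0.
have {}x1 : 0 < 1 - x by rewrite subr_gt0.
rewrite -(pmulr_lgt0 _ unit_gt0) h; case: f {h} => [[a b] c]; rewrite /agt0 /=.
have hw := @wR_ge0 R; have hw' := @wR_gt0 R.
case/andP => /and5P[/hw h1 /hw h2 /hw h3 /hw h4 _].
(* [averts] runs through (0, 0), (0, 1), (1, 1), (1, beta^2), whereas [ev_bilinear] takes these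
   vertices in the order (0, 0), (1, beta^2), (0, 1), (1, 1). *)
case/or4P => [|||/orP[|//]] /hw'; move: h1 h2 h3 h4;
  rewrite !(wR_add, wR_mul) wRbe2 => h1 h2 h3 h4 h5.
- by apply: bilinear_gt0 => //; constructor 1.
- by apply: bilinear_gt0 => //; constructor 3.
- by apply: bilinear_gt0 => //; constructor 4.
- by apply: bilinear_gt0 => //; constructor 2.
Qed.

End Positivity.
End EvalAff.

(* The ten outer normals u_0, - u_3, u_1, - u_4, ... in cyclic order: the k-th one
   makes the angle k pi / 5 with u_0. *)
Definition unormal (R : realType) (k : nat) (p : plane R) : R :=
  if odd k then - udot (k + 5)./2 p else udot k./2 p.

(* (k, true, b) and (k, false, b) stand for the open and the closed half-plane
   where the k-th normal is less than, resp. at most, b. *)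
Notation halfplane := (nat * bool * aff)%type.

(* Up to scaling, all the relations with positive coefficients between two or three
   normals; the coefficients come from sin (2 pi / 5) = omega sin (pi / 5). *)
Definition relations : seq (seq (nat * Zw)) :=
  [seq [:: (k, w1); (k + 5, w1)]%N | k <- iota 0 5] ++
  [seq [:: (k, w1); ((k + 4) %% 10, wom); ((k + 8) %% 10, w1)]%N | k <- iota 0 10] ++
  [seq [:: (k, wom); ((k + 4) %% 10, wom); ((k + 7) %% 10, w1)]%N | k <- iota 0 10].

(** Searches for one half-plane per normal of the relation. The flag records whether an open one was
    chosen: the sum of the inequalities is then 0 < [acc], refuted by [acc] <= 0, and otherwise 0 <=
    [acc], refuted only by [acc] < 0. *)
Fixpoint farkas (bs : seq (seq (bool * aff))) (rel : seq (nat * Zw))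
    (acc : aff) (strict : bool) : bool :=
  match rel with
  | [::] => if strict then age0 (aopp acc) else agt0 (aopp acc)
  | (k, c) :: rel' =>
      has (fun sb => farkas bs rel' (aadd acc (ascale c sb.2)) (sb.1 || strict))
        (nth [::] bs k)
  end.

Definition buckets (L : seq halfplane) : seq (seq (bool * aff)) :=
  [seq [seq (h.1.2, h.2) | h <- L & h.1.1 == k] | k <- iota 0 10].

Definition infeasible_hp (L : seq halfplane) : bool :=
  let bs := buckets L in has (fun rel => farkas bs rel a0 false) relations.

Section Infeasible.
Variables (R : realType) (x y : R).
Hypothesis hxy : parameters x y.
Local Notation ev := (ev x y).
Implicit Types p : plane R.

Definition hsat (p : plane R) (h : halfplane) : Prop :=
  if h.1.2 then unormal h.1.1 p < ev h.2 else unormal h.1.1 p <= ev h.2.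

Lemma relationsP rel : rel \in relations ->
  all (fun kc => (kc.1 < 10)%N && wge0 kc.2 && wgt0 kc.2) rel /\
  forall p, \sum_(kc <- rel) wR R kc.2 * unormal kc.1 p = 0.
Proof.
move=> hrel; split; first by move: rel hrel; apply/allP; vm_compute.
move=> [a b]; have h := omega_sqr R.
have ha : omega ^+ 2 * a = omega * a + a by rewrite h mulrDl mul1r.
have hb : omega ^+ 2 * b = omega * b + b by rewrite h mulrDl mul1r.
move: hrel; do ![rewrite in_cons; case/orP => [/eqP -> |]]; last by [];
  rewrite !big_cons big_nil /= ?wR1 ?wRom /unormal /udot /= ?betaE; lra.
Qed.

(** Induction along the relation: [c] is the value at p of the part already summed, which [acc]
    bounds; at the end of the relation [c] is 0. *)
Lemma farkasP bs rel acc strict p c :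
  all (fun kc => (kc.1 < 10)%N && wge0 kc.2 && wgt0 kc.2) rel ->
  (forall k sb, sb \in nth [::] bs k -> hsat p (k, sb.1, sb.2)) ->
  c + \sum_(kc <- rel) wR R kc.2 * unormal kc.1 p = 0 ->
  (if strict then c < ev acc else c <= ev acc) ->
  farkas bs rel acc strict -> False.
Proof.
move=> + hbs; elim: rel acc strict c => [|[k z] rel IH] acc strict c /=.
  rewrite big_nil addr0 => _ ->.
  case: strict => h /=; [move/(age0P hxy)|move/(agt0P hxy)]; rewrite ev_opp.
    by rewrite oppr_ge0 leNgt h.
  by rewrite oppr_gt0 ltNge h.
case/andP => /andP[/andP[_ _] hz] hrel; have {}hz := wR_gt0 R hz; rewrite big_cons /= addrA => hc hacc.
case/hasP => -[st b] /hbs; rewrite /hsat /= => hb; apply: IH => //; first exact: hc.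
rewrite ev_add ev_scale.
case: st hb => /= hb; case: strict hacc => hacc.
- by rewrite ltrD// ltr_pM2l.
- by rewrite ler_ltD// ltr_pM2l.
- by rewrite ltr_leD// ler_pM2l.
- by rewrite lerD// ler_pM2l.
Qed.

Lemma infeasible_hpP L p : infeasible_hp L -> (forall h, h \in L -> hsat p h) -> False.
Proof.
case/hasP => rel /relationsP[h1 h2] + hL; apply: (@farkasP _ _ _ _ p 0) => //.
- move=> k sb; have [hk|hk] := ltnP k 10; last first.
    by rewrite nth_default // size_map size_iota.
  rewrite (nth_map 0%N) ?size_iota// nth_iota// add0n => /mapP[h].
  by rewrite mem_filter => /andP[/eqP <- /hL +] -> /=; case: h => -[].
- by rewrite add0r.
- by rewrite ev0.
Qed.

End Infeasible.

(** * Tiles and isometries *)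

(* (m, true, b) stands for u_m . p < b and (m, false, b) for b <= u_m . p. *)
Notation constr := (nat * bool * aff)%type.
Notation ctile := (seq constr).
Notation cpoint := (aff * aff)%type.
Notation ciso := (cpoint * nat)%type.

(** The normal u_m has index 2m, and opposite normals differ by 5, so a lower bound on u_m becomes
    an upper bound on the normal 2m + 5. *)
Definition to_halfplane (c : constr) : halfplane :=
  let k := (c.1.1 %% 5).*2 in
  if c.1.2 then (k, true, c.2) else ((k + 5) %% 10, false, aopp c.2)%N.

Definition negc (c : constr) : constr := (c.1.1, ~~ c.1.2, c.2).

Definition infeasible (L : ctile) : bool := infeasible_hp (map to_halfplane L).
Definition included (P Q : ctile) : bool := all (fun c => infeasible (negc c :: P)) Q.
Definition disjointb (P Q : ctile) : bool := infeasible (P ++ Q).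

(** Cuts [cur] successively along the sides of a convex polygon. The part beyond a side is handed to
    [cov]; what remains keeps that side as a further constraint, so the parts handed over do not
    overlap. *)
Fixpoint subtract (cov : ctile -> bool) (cur todo : ctile) : bool :=
  if todo is c :: todo' then
    let cur' := negc c :: cur in
    if infeasible cur' then subtract cov cur todo'
    else cov cur' && subtract cov (c :: cur) todo'
  else true.

(** The disjointness test comes first so that L is not cut along the sides of a polygon that it does
    not meet. *)
Fixpoint covered (L : ctile) (Ps : seq ctile) {struct Ps} : bool :=
  infeasible L ||
  if Ps is P :: Ps' then
    if disjointb L P then covered L Ps'
    else subtract (fun L' => covered L' Ps') L P
  else false.

Definition cdot (m : nat) (p : cpoint) : aff :=
  nth a0 [:: p.1; p.2; aadd (aopp p.1) (ascale wbe p.2);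
             ascale (wopp wbe) (aadd p.1 p.2); aadd (ascale wbe p.1) (aopp p.2)] (m %% 5).

Definition cadd (p q : cpoint) : cpoint := (aadd p.1 q.1, aadd p.2 q.2).
Definition crot1 (p : cpoint) : cpoint := (aadd (ascale wbe p.1) (aopp p.2), p.1).
Definition capply (T : ciso) (p : cpoint) : cpoint := cadd (iter T.2 crot1 p) T.1.

Definition image_tile (T : ciso) (P : ctile) : ctile :=
  [seq let m := ((c.1.1 + T.2) %% 5)%N in (m, c.1.2, aadd c.2 (cdot m T.1)) | c <- P].

Definition ccomp (S T : ciso) : ciso := (capply S T.1, ((S.2 + T.2) %% 5)%N).
Definition cid : ciso := ((a0, a0), 0%N).

Section EvalTile.
Variables (R : realType) (x y : R).
Local Notation ev := (ev x y).
Implicit Types (p q : plane R) (P Q L : ctile) (T S : ciso).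

Definition csat p (c : constr) : Prop :=
  if c.1.2 then udot c.1.1 p < ev c.2 else ev c.2 <= udot c.1.1 p.

Definition tl P : set (plane R) :=
  tile [seq c.1.1 | c <- P] [seq (if c.1.2 then 1 else -1 : int) | c <- P]
       [seq ev c.2 | c <- P].

Definition evp (p : cpoint) : plane R := (ev p.1, ev p.2).
Definition evT T : plane R -> plane R := TR (evp T.1) T.2.

Lemma tlP P p : tl P p <-> forall c, c \in P -> csat p c.
Proof.
pose c0 : constr := (0%N, true, a0).
split=> [h c /(nthP c0)[i hi <-]|h i].
  have := h i; rewrite size_map => /(_ hi).
  by rewrite !(nth_map c0)// /csat; case: (nth c0 P i).1.2.
rewrite size_map => hi; have := h _ (mem_nth c0 hi).
by rewrite !(nth_map c0)// /csat; case: (nth c0 P i).1.2.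
Qed.

Lemma tl_cons c P p : tl (c :: P) p <-> csat p c /\ tl P p.
Proof.
split=> [/tlP h|[h1 /tlP h2]].
  by split; [apply: h; rewrite mem_head|apply/tlP => d hd; apply: h; rewrite inE hd orbT].
by apply/tlP => d; rewrite inE => /orP[/eqP ->|/h2].
Qed.

Lemma tl_cat P Q : tl (P ++ Q) = tl P `&` tl Q.
Proof.
apply/seteqP; split=> p; first move=> /tlP h.
  by split; apply/tlP => c hc; apply: h; rewrite mem_cat hc ?orbT.
by case=> /tlP h1 /tlP h2; apply/tlP => c; rewrite mem_cat => /orP[/h1|/h2].
Qed.

Lemma csat_neg p c : ~ csat p c -> csat p (negc c).
Proof.
by case: c => -[m []] b; rewrite /csat /=; [move/negP; rewrite -leNgt|move/negP; rewrite -ltNge].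
Qed.

Lemma udot_mod m p : udot (m %% 5) p = udot m p.
Proof. by rewrite /udot modn_mod. Qed.

Lemma unormal_even m p : unormal (m %% 5).*2 p = udot m p.
Proof. by rewrite /unormal odd_double doubleK udot_mod. Qed.

Lemma unormal_odd m p : unormal (((m %% 5).*2 + 5) %% 10) p = - udot m p.
Proof.
rewrite -udot_mod; have : (m %% 5 < 5)%N by rewrite ltn_mod.
by move: (m %% 5)%N => [|[|[|[|[|k]]]]].
Qed.

Lemma hsat_to_halfplane p c : csat p c -> hsat x y p (to_halfplane c).
Proof.
rewrite /csat /hsat /to_halfplane; case: c.1.2 => /=; first by rewrite unormal_even.
by rewrite unormal_odd ev_opp lerN2.
Qed.

Lemma udotD m p q : udot m (p.1 + q.1, p.2 + q.2) = udot m p + udot m q.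
Proof.
rewrite /udot; have : (m %% 5 < 5)%N by rewrite ltn_mod.
by move: (m %% 5)%N => [|[|[|[|[|k]]]]] //= _; ring.
Qed.

Lemma udotZ m (a : R) p : udot m (a * p.1, a * p.2) = a * udot m p.
Proof.
rewrite /udot; have : (m %% 5 < 5)%N by rewrite ltn_mod.
by move: (m %% 5)%N => [|[|[|[|[|k]]]]] //= _; ring.
Qed.

Lemma udot_rot1 m p : udot m.+1 (rot1 p) = udot m p.
Proof.
rewrite /udot -addn1 -modnDml; have : (m %% 5 < 5)%N by rewrite ltn_mod.
have hb := beta_sqr R.
have h1 : beta ^+ 2 * p.1 = p.1 - beta * p.1 by rewrite hb; ring.
have h2 : beta ^+ 2 * p.2 = p.2 - beta * p.2 by rewrite hb; ring.
by move: (m %% 5)%N => [|[|[|[|[|k]]]]] //= _; rewrite /rot1 /=; lra.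
Qed.

Lemma udot_rotR m n p : udot (m + n) (rotR n p) = udot m p.
Proof. by elim: n => [|n IH]; rewrite ?addn0// addnS /rotR iterS udot_rot1. Qed.

Lemma udot_TR m n d p : udot (m + n) (TR d n p) = udot m p + udot (m + n) d.
Proof. by rewrite /TR /= /trans udotD udot_rotR. Qed.

Lemma ev_cdot m (p : cpoint) : ev (cdot m p) = udot m (evp p).
Proof.
rewrite /cdot /udot; have : (m %% 5 < 5)%N by rewrite ltn_mod.
move: (m %% 5)%N => [|[|[|[|[|k]]]]] //= _;
  by rewrite ?(ev_add, ev_opp, ev_scale, wR_opp, wRbe) //=; ring.
Qed.

Lemma evp_rot (n : nat) (p : cpoint) : evp (iter n crot1 p) = rotR n (evp p).
Proof.
by elim: n => //= n <-; rewrite {1}/evp /= ev_add ev_scale ev_opp wRbe.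
Qed.

Lemma evp_add (p q : cpoint) : evp (cadd p q) = trans (evp q) (evp p).
Proof. by rewrite /evp /= !ev_add. Qed.

Lemma evp_apply T (p : cpoint) : evp (capply T p) = evT T (evp p).
Proof. by rewrite evp_add evp_rot. Qed.

Lemma rotR_add n p q :
  rotR n (p.1 + q.1, p.2 + q.2) = ((rotR n p).1 + (rotR n q).1, (rotR n p).2 + (rotR n q).2).
Proof. by elim: n => //= n ->; rewrite /rot1 /=; congr (_, _); ring. Qed.

Lemma plane_eq p q : (forall m, udot m p = udot m q) -> p = q.
Proof. by case: p q => a b [c d] h; congr (_, _); [exact: (h 0%N)|exact: (h 1%N)]. Qed.

Lemma rotR_mod n p : rotR (n %% 5) p = rotR n p.
Proof.
suff h k q : rotR (k * 5) q = q.
  by rewrite {2}(divn_eq n 5) addnC /rotR iterD [iter (_ * _) _ _]h.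
apply: plane_eq => m; rewrite -[RHS](udot_rotR m (k * 5)).
by rewrite -[in RHS]udot_mod -modnDmr modnMl addn0 udot_mod.
Qed.

Lemma evT_comp S T : evT (ccomp S T) = evT S \o evT T.
Proof.
apply/funext => p /=; rewrite /evT /TR /ccomp /= evp_apply /evT /TR /=.
rewrite rotR_mod /rotR iterD -!/(rotR _ _) /trans rotR_add /=.
by congr (_, _); ring.
Qed.

Lemma evT_id : evT cid = id.
Proof. by apply/funext => -[a b]; rewrite /evT /TR /= /trans /evp /= ev0 !addr0. Qed.

Definition rot1_inv p : plane R := (p.2, beta * p.2 - p.1).

Lemma rot1K : cancel (@rot1 R) rot1_inv.
Proof. by case=> a b; rewrite /rot1 /rot1_inv /=; congr (_, _); ring. Qed.

Lemma rot1_invK : cancel rot1_inv (@rot1 R).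
Proof. by case=> a b; rewrite /rot1 /rot1_inv /=; congr (_, _); ring. Qed.

Lemma TR_bij d n : bijective (TR d n : plane R -> plane R).
Proof.
apply: bij_comp.
  by exists (trans (- d.1, - d.2)) => -[a b]; rewrite /trans /= ?(addrK, subrK).
elim: n => [|n [g h1 h2]]; first by exists id.
exists (g \o rot1_inv) => p /=; first by rewrite rot1K.
by rewrite h2 rot1_invK.
Qed.

Lemma image_tileP T P p : tl (image_tile T P) (evT T p) <-> tl P p.
Proof.
have hm (c : constr) :
    csat (evT T p) ((c.1.1 + T.2) %% 5, c.1.2, aadd c.2 (cdot ((c.1.1 + T.2) %% 5) T.1))%N
    <-> csat p c.
  rewrite /csat /= ev_add ev_cdot !udot_mod udot_TR.
  by case: c.1.2; rewrite ?lerD2r ?ltrD2r.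
split=> /tlP h; apply/tlP => c.
  by move=> hc; apply/hm; apply: h; apply/mapP; exists c.
by case/mapP => d hd ->; apply/hm/h.
Qed.

Lemma image_tileE T P : evT T @` tl P = tl (image_tile T P).
Proof.
apply/seteqP; split=> [_ [p hp <-]|p hp]; first exact/image_tileP.
have [g _ gK] := TR_bij (evp T.1) T.2; have {}gK : cancel g (evT T) := gK.
by exists (g p); [apply/(image_tileP T); rewrite gK|rewrite gK].
Qed.

Section Decision.
Hypothesis hxy : parameters x y.

Lemma infeasibleP L p : infeasible L -> tl L p -> False.
Proof.
move=> h /tlP hL; apply: (infeasible_hpP hxy (p := p) h) => _ /mapP[c hc ->].
exact/hsat_to_halfplane/hL.
Qed.

Lemma includedP P Q : included P Q -> tl P `<=` tl Q.
Proof.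
move=> /allP h p hp; apply/tlP => c hc; apply: contrapT => /csat_neg hn.
by apply: (infeasibleP (h _ hc) (p := p)); apply/tl_cons.
Qed.

Lemma disjointbP P Q : disjointb P Q -> tl P `&` tl Q = set0.
Proof.
by move=> h; rewrite -tl_cat -subset0 => p; apply: infeasibleP.
Qed.

Lemma subtractP (cov : ctile -> bool) (G : Prop) cur todo p :
  (forall L, cov L -> tl L p -> G) ->
  subtract cov cur todo -> tl cur p -> G \/ tl todo p.
Proof.
move=> hG; elim: todo cur => [|c todo IH] cur /=; first by move=> _ _; right; apply/tlP.
case: ifP => [hi hs hp|_ /andP[hc hs] hp].
  have hcp : csat p c.
    by apply: contrapT => /csat_neg hn; apply: (infeasibleP hi (p := p)); apply/tl_cons.
  by have [|h] := IH _ hs hp; [left|right; apply/tl_cons].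
have [hcp|/csat_neg hn] := pselect (csat p c); last by left; apply: hG hc _; apply/tl_cons.
by have [||h] := IH _ hs; [apply/tl_cons|left|right; apply/tl_cons].
Qed.

Lemma coveredP L Ps p : covered L Ps -> tl L p -> exists2 P, P \in Ps & tl P p.
Proof.
elim: Ps L => [|P Ps IH] L /=; first by rewrite orbF => /infeasibleP h /h.
case/orP => [/infeasibleP h /h //|].
have IH' L' : covered L' Ps -> tl L' p -> exists2 Q, Q \in P :: Ps & tl Q p.
  by move=> hc /(IH _ hc) [Q hQ hp]; exists Q => //; rewrite inE hQ orbT.
case: ifP => [_|_ hs /(subtractP IH' hs) [//|hp]]; first exact: IH'.
by exists P; rewrite ?mem_head.
Qed.

End Decision.
End EvalTile.

(** * Interiors and closures *)

Definition uvec (m : nat) : Zw * Zw :=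
  nth (w1, w0) [:: (w1, w0); (w0, w1); (wopp w1, wbe); (wopp wbe, wopp wbe); (wbe, wopp w1)] m.

(* The inverse of the determinant of u_m and u_(m + d) in the basis dual to the
   coordinates. *)
Definition inv_det (d : nat) : Zw := nth w0 [:: w0; w1; wom; wopp wom; wopp w1] d.

(** Cramer's rule for the two boundary lines. For parallel lines [inv_det] is 0 and the result is
    the origin; it counts as a vertex only if it passes [in_closed], like any other point. *)
Definition meet_point (c d : constr) : cpoint :=
  let u := uvec c.1.1 in let v := uvec d.1.1 in
  let k := inv_det ((d.1.1 + 5 - c.1.1) %% 5) in
  (ascale k (aadd (ascale v.2 c.2) (aopp (ascale u.2 d.2))),
   ascale k (aadd (ascale u.1 d.2) (aopp (ascale v.1 c.2)))).

Definition slack (p : cpoint) (c : constr) : aff :=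
  if c.1.2 then aadd c.2 (aopp (cdot c.1.1 p)) else aadd (cdot c.1.1 p) (aopp c.2).

Definition in_closed (P : ctile) (p : cpoint) : bool := all (fun c => age0 (slack p c)) P.

Definition vertices (P : ctile) : seq cpoint :=
  [seq p <- [seq meet_point c d | c <- P, d <- P] | in_closed P p].

(** The witness is the barycentre of the vertices. The sum g of the n vertices is compared with
    bounds multiplied by n, which avoids dividing in Z[omega]. *)
Definition has_interior (P : ctile) : bool :=
  let vs := vertices P in
  let n : Zw := (Z.of_nat (size vs), Z0) in
  let g := foldr cadd (a0, a0) vs in
  (0 < size vs)%N &&
  all (fun c : constr => agt0 (slack g (c.1, ascale n c.2))) P.

Definition box : ctile :=
  let b n : aff := acst (n, Z0) in
  [:: (0%N, true, b (Zpos 4)); (1%N, true, b (Zpos 4));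
      (0%N, false, b (Zneg 4)); (1%N, false, b (Zneg 4))].

Definition polygonb (P : ctile) : bool := has_interior P && included P box.

Section Topology.
Variables (R : realType) (x y : R).
Hypothesis hxy : parameters x y.
Local Notation ev := (ev x y).
Local Notation tl := (tl x y).
Local Notation evp := (evp x y).
Local Notation csat := (csat x y).
Implicit Types (p q z : plane R) (P Q : ctile).

Definition rslack p (c : constr) : R :=
  if c.1.2 then ev c.2 - udot c.1.1 p else udot c.1.1 p - ev c.2.

Lemma ev_slack (p : cpoint) c : ev (slack p c) = rslack (evp p) c.
Proof. by rewrite /slack /rslack; case: c.1.2; rewrite ev_add ev_opp ev_cdot. Qed.

Lemma rslack_sat p c : 0 < rslack p c -> csat p c.
Proof. by rewrite /rslack /csat; case: c.1.2; rewrite subr_gt0// => /ltW. Qed.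

Lemma rslack_convex (l : R) p q c :
  rslack ((1 - l) * p.1 + l * q.1, (1 - l) * p.2 + l * q.2) c =
  (1 - l) * rslack p c + l * rslack q c.
Proof.
rewrite /rslack; have -> m : udot m ((1 - l) * p.1 + l * q.1, (1 - l) * p.2 + l * q.2)
    = (1 - l) * udot m p + l * udot m q.
  by rewrite -(udotZ m (1 - l) p) -(udotZ m l q) -udotD.
by case: c.1.2; ring.
Qed.

Lemma zR_nat n : zR R (Z.of_nat n) = n%:R.
Proof. by rewrite /zR (_ : int_of_Z (Z.of_nat n) = n)//; lia. Qed.

Lemma has_interiorP P : has_interior P -> exists z, forall c, c \in P -> 0 < rslack z c.
Proof.
case/andP; set n := size _; set g := foldr _ _ _ => n0 /allP h.
have {}n0 : 0 < n%:R :> R by rewrite ltr0n.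
exists (n%:R^-1 * (evp g).1, n%:R^-1 * (evp g).2) => c /h /(agt0P hxy).
rewrite ev_slack /rslack !udotZ /= ev_scale /wR /= mul0r addr0 zR_nat => hc.
rewrite -(pmulr_rgt0 _ n0); move: hc.
by case: c.1.2; rewrite mulrBr mulVKf ?lt0r_neq0.
Qed.

Lemma udot_le m p (e : R) : `|p.1| <= e -> `|p.2| <= e -> udot m p <= 2 * e.
Proof.
rewrite !ler_norml => /andP[h1 h2] /andP[h3 h4].
have b0 := beta_gt0 R; have b1 := beta_lt1 R.
rewrite /udot; have : (m %% 5 < 5)%N by rewrite ltn_mod.
by move: (m %% 5)%N => [|[|[|[|[|k]]]]] //= _; nra.
Qed.

Lemma rslack_close p q c (e : R) : `|p.1 - q.1| <= e -> `|p.2 - q.2| <= e ->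
  rslack p c - 2 * e <= rslack q c.
Proof.
move=> h1 h2; have hu m (a b : plane R) : udot m a = udot m (a.1 - b.1, a.2 - b.2) + udot m b.
  by rewrite -udotD !subrK; case: a.
rewrite /rslack; case: c.1.2.
  rewrite (hu _ q p); have := @udot_le c.1.1 (q.1 - p.1, q.2 - p.2) e.
  by rewrite /= distrC h1 distrC h2 => /(_ isT isT); lra.
rewrite (hu _ p q); have := @udot_le c.1.1 (p.1 - q.1, p.2 - q.2) e.
by rewrite /= h1 h2 => /(_ isT isT); lra.
Qed.

Lemma interior_tl P z : (forall c, c \in P -> 0 < rslack z c) -> interior (tl P) z.
Proof.
move=> h; apply: (@filterS _ (nbhs z) _ [set p | forall c, c \in P -> csat p c]).
  by move=> p hp; apply/tlP.
elim: P h => [|c P IH] h; first by apply: filterE => p c.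
have hc : nbhs z [set p | csat p c].
  have h0 : 0 < rslack z c by apply: h; rewrite mem_head.
  apply/nbhs_ballP; exists (rslack z c / 4) => /=; first by rewrite divr_gt0.
  move=> q [/= /ltW h1 /ltW h2]; apply: rslack_sat.
  by have := rslack_close c h1 h2; lra.
apply: filterS (filterI hc (IH _)) => [q [h1 h2] d|d hd]; last by apply: h; rewrite inE hd orbT.
by rewrite inE => /orP[/eqP ->|/h2].
Qed.

(** On the segment from p to z every slack is positive except possibly at p. The ratio [l] is chosen
    so that the point moves by at most e / 2. *)
Lemma closure_tl P z p : (forall c, c \in P -> 0 < rslack z c) ->
  (forall c, c \in P -> 0 <= rslack p c) -> closure (tl P) p.
Proof.
move=> hz hp B /nbhs_ballP[e /= e0 hB].
pose M := `|z.1 - p.1| + `|z.2 - p.2| + e.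
have M0 : 0 < M by rewrite ltr_wpDl// addr_ge0.
pose l := e / (M * 2).
have l0 : 0 < l by rewrite divr_gt0// mulr_gt0.
have hlM : l * M = e / 2 by rewrite /l; field; rewrite lt0r_neq0.
have l1 : l < 1.
  rewrite -(ltr_pM2r M0) mul1r hlM /M; have := normr_ge0 (z.1 - p.1).
  by have := normr_ge0 (z.2 - p.2); lra.
exists ((1 - l) * p.1 + l * z.1, (1 - l) * p.2 + l * z.2); split.
  apply/tlP => c hc; apply: rslack_sat; rewrite rslack_convex.
  apply: ltr_wpDl; last by apply: mulr_gt0 => //; apply: hz.
  by apply: mulr_ge0; [rewrite subr_ge0 ltW|apply: hp].
have hl (a b : R) : `|b - a| <= M -> `|a - ((1 - l) * a + l * b)| < e.
  move=> hab; rewrite (_ : _ - _ = - (l * (b - a))); last by ring.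
  rewrite normrN normrM gtr0_norm// (@le_lt_trans _ _ (e / 2)) ?ltr_pdivrMr ?ltr_pMr ?ltr1n//.
  by rewrite -hlM ler_pM2l.
apply: hB; split; apply: hl; rewrite /M /=.
  by have := normr_ge0 (z.2 - p.2); lra.
by have := normr_ge0 (z.1 - p.1); lra.
Qed.

Lemma polygonbP P : polygonb P -> polygon_with (size P) (tl P).
Proof.
case/andP => /has_interiorP[z hz] hb; split.
  by do 3 eexists; split; last reflexivity; rewrite size_map.
split; last by exists z; apply: interior_tl.
exists 4; split; first exact: num_real.
move=> M hM p hp; have /tlP h := includedP hxy hb hp.
have hc n : ev (acst (n, Z0)) = zR R n by rewrite ev_cst /wR /= mul0r addr0.
have h4 : zR R (Zpos 4) = 4 by [].
have h4' : zR R (Zneg 4) = -4 by rewrite (zRN R (Zpos 4)) h4.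
suff : Num.max `|p.1| `|p.2| <= M by [].
rewrite ge_max !ler_norml.
have := h (0%N, true, acst (Zpos 4, Z0)); have := h (1%N, true, acst (Zpos 4, Z0)).
have := h (0%N, false, acst (Zneg 4, Z0)); have := h (1%N, false, acst (Zneg 4, Z0)).
rewrite /csat /= !hc h4 h4' => /(_ isT) h1 /(_ isT) h2 /(_ isT) h3 /(_ isT) h5.
move: h1 h2 h3 h5; rewrite /udot /= => h1 h2 h3 h5.
by do !(apply/andP; split); apply: ltW; lra.
Qed.

Lemma polygonb_polygon P : polygonb P -> polygon (tl P).
Proof. by exists (size P); apply: polygonbP. Qed.

Lemma polygonb_neq0 P : polygonb P -> tl P !=set0.
Proof.
case/andP => /has_interiorP[z hz] _; exists z.
by apply/tlP => c /hz /rslack_sat.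
Qed.

Lemma has_interior_neq0 P : has_interior P -> tl P !=set0.
Proof.
case/has_interiorP => z hz; exists z.
by apply/tlP => c /hz /rslack_sat.
Qed.

Lemma in_closedP P (p : cpoint) : in_closed P p -> forall c, c \in P -> 0 <= rslack (evp p) c.
Proof. by move=> /allP h c /h /(age0P hxy); rewrite ev_slack. Qed.

End Topology.

(** * Induction on subdomains *)

Record system := System { sdom : ctile; spieces : seq (ctile * ciso) }.

Definition piece (S : system) (k : nat) : ctile * ciso := nth ([::], cid) (spieces S) k.

(** P remains the initial piece throughout; [T] is the isometry accumulated along the letters
    already read. *)
Fixpoint stays (S : system) (T : ciso) (w : seq nat) (P : ctile) : bool :=
  if w is k :: w' then
    [&& (k < size (spieces S))%N, included (image_tile T P) (piece S k).1
      & stays S (ccomp (piece S k).2 T) w' P]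
  else true.

Fixpoint tower (S : system) (T : ciso) (w : seq nat) (P : ctile) : seq ctile :=
  if w is k :: w' then image_tile T P :: tower S (ccomp (piece S k).2 T) w' P else [::].

Definition word_iso (S : system) : ciso -> seq nat -> ciso :=
  foldl (fun T k => ccomp (piece S k).2 T).

(** [behead] drops level 0, which lies in Y. That the other levels avoid Y makes the length of w the
    first return time and not just a return time. *)
Definition returns (S : system) (Y : ctile) (wP : seq nat * ctile) : bool :=
  let: (w, P) := wP in
  [&& w != [::], included P Y, stays S cid w P,
      all (fun Q => disjointb Q Y) (behead (tower S cid w P))
    & included (image_tile (word_iso S cid w) P) Y].

Definition periodic (S : system) (wP : seq nat * ctile) : bool :=
  let: (w, P) := wP in
  let Q := image_tile (word_iso S cid w) P in
  [&& w != [::], polygonb P, stays S cid w P,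
      all (fun Q => disjointb Q P) (behead (tower S cid w P))
    & included Q P && included P Q].

(** Disjointness of the pieces follows from the distinctness of the words: a point has a single
    itinerary up to its first return. *)
Definition first_return_data (S : system) (Y : ctile) (data : seq (seq nat * ctile)) : bool :=
  [&& all (returns S Y) data, covered Y [seq wP.2 | wP <- data],
      uniq [seq wP.1 | wP <- data] & all (fun wP => has_interior wP.2) data].

Definition induced (S : system) (Y : ctile) (data : seq (seq nat * ctile)) : system :=
  System Y [seq (wP.2, word_iso S cid wP.1) | wP <- data].

Definition dressedb (S : system) : bool :=
  all (fun PT => polygonb PT.1 && included (image_tile PT.2 PT.1) (sdom S)) (spieces S).

Section Dynamics.
Variables (R : realType) (x y : R).
Hypothesis hxy : parameters x y.
Local Notation tl := (tl x y).
Local Notation evT := (evT x y).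
Implicit Types (D : dressed R) (S : system) (p q : plane R) (P Q Y : ctile) (w : seq nat).

(** [lb] numbers the labels with nonempty cells. All other labels have empty cells, which is how a
    finite system can describe a dressed domain labelled by words. *)
Record models D S (lb : nat -> lab D) : Prop := Models {
  models_dom : dom D = tl (sdom S);
  models_cell : forall k, (k < size (spieces S))%N -> cell (lb k) = tl (piece S k).1;
  models_iso : forall k, (k < size (spieces S))%N -> iso (lb k) = evT (piece S k).2;
  models_rho : forall k p, (k < size (spieces S))%N -> tl (piece S k).1 p ->
    rho D p = evT (piece S k).2 p;
  models_lab : forall l : lab D, cell l !=set0 ->
    exists2 k, (k < size (spieces S))%N & l = lb k;
  models_disj : forall j k p, (j < size (spieces S))%N -> (k < size (spieces S))%N ->
    tl (piece S j).1 p -> tl (piece S k).1 p -> j = k;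
  models_neq0 : forall k, (k < size (spieces S))%N -> tl (piece S k).1 !=set0;
  models_cover : forall p, dom D p <->
    exists2 k, (k < size (spieces S))%N & tl (piece S k).1 p }.

Section Model.
Variables (D : dressed R) (S : system) (lb : nat -> lab D).
Hypothesis hD : models S lb.
Local Notation n := (size (spieces S)).

Lemma models_inj j k : (j < n)%N -> (k < n)%N -> lb j = lb k -> j = k.
Proof.
move=> hj hk h; have [p hp] := models_neq0 hD hj.
by apply: (models_disj hD hj hk hp); rewrite -(models_cell hD hk) -h (models_cell hD hj).
Qed.

Lemma models_lab_inj (l l' : lab D) p : cell l p -> cell l' p -> l = l'.
Proof.
move=> hp hp'.
have [j hj ej] : exists2 k, (k < n)%N & l = lb k by apply: (models_lab hD); exists p.
have [k hk ek] : exists2 k, (k < n)%N & l' = lb k by apply: (models_lab hD); exists p.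
move: hp hp'; rewrite ej ek (models_cell hD hj) (models_cell hD hk) => hp hp'.
by rewrite (models_disj hD hj hk hp hp').
Qed.

Lemma models_atoms (A : set (plane R)) :
  atoms D A <-> exists2 k, (k < n)%N & A = tl (piece S k).1.
Proof.
split=> [[l [-> hl]]|[k hk ->]].
  by have [k hk ->] := models_lab hD hl; exists k => //; exact: models_cell.
by exists (lb k); rewrite (models_cell hD hk); split=> //; exact: models_neq0 hD _ hk.
Qed.

Lemma models_atom_sub k : (k < n)%N -> tl (piece S k).1 `<=` dom D.
Proof. by move=> hk p hp; apply/(models_cover hD); exists k. Qed.

Lemma models_dressed : dressedb S -> dressed_domain D.
Proof.
move=> hS.
have hp k : (k < n)%N -> polygonb (piece S k).1 && included (image_tile (piece S k).2 (piece S k).1) (sdom S).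
  by move=> hk; apply: (allP hS); exact: mem_nth.
split.
- split; last first.
    by move=> A /models_atoms[k /hp /andP[h _] ->]; exact: (polygonb_polygon hxy).
  apply: (@sub_finite_set _ _ ((fun k => tl (piece S k).1) @` `I_n)).
    by move=> A /models_atoms[k hk ->]; exists k.
  exact: finite_image.
- apply/seteqP; split=> p.
    by case=> A /models_atoms[k hk ->]; exact: models_atom_sub.
  move=> /(models_cover hD)[k hk hkp]; exists (tl (piece S k).1) => //.
  by apply/models_atoms; exists k.
- move=> A B /models_atoms[j hj ->] /models_atoms[k hk ->] [p [h1 h2]].
  by rewrite (models_disj hD hj hk h1 h2).
- move=> p /(models_cover hD)[k hk hkp]; rewrite (models_rho hD hk hkp) (models_dom hD).
  by apply: (includedP hxy (andP (hp k hk)).2); rewrite -image_tileE; exists p.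
- move=> l hl; have [k hk ->] := models_lab hD hl.
  rewrite (models_iso hD hk); split; first by do 2 eexists.
  by move=> p; rewrite (models_cell hD hk) => /(models_rho hD hk).
Qed.

Lemma stays_iso T w P p : stays S T w P -> tl P p ->
  iter (size w) (rho D) (evT T p) = evT (word_iso S T w) p.
Proof.
elim: w T => [|k w IH] T //= /and3P[hk hi hs] hp.
rewrite -iterS iterSr -(IH _ hs hp) evT_comp (models_rho hD hk) //.
by apply: (includedP hxy hi); rewrite -image_tileE; exists p.
Qed.

Lemma stays_iso_word T w P : stays S T w P ->
  iso_word [seq lb k | k <- w] \o evT T = evT (word_iso S T w).
Proof.
elim: w T => [|k w IH] T //= /and3P[hk hi hs].
by rewrite -(IH _ hs) evT_comp -(models_iso hD hk).
Qed.

Lemma stays_itinerary T w P p : stays S T w P -> tl P p ->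
  itinerary [seq lb k | k <- w] (evT T p).
Proof.
elim: w T => [|k w IH] T //= /and3P[hk hi hs] hp.
have h : tl (piece S k).1 (evT T p).
  by apply: (includedP hxy hi); rewrite -image_tileE; exists p.
rewrite (models_cell hD hk); split=> //.
by rewrite (models_rho hD hk h) -[evT _ (evT T p)]/((evT _ \o evT T) p) -evT_comp; apply: IH.
Qed.

Lemma size_tower T w P : size (tower S T w P) = size w.
Proof. by elim: w T => //= k w IH T; rewrite IH. Qed.

Lemma tower_iter T w P k : stays S T w P -> (k < size w)%N ->
  [set iter k (rho D) (evT T p) | p in tl P] = tl (nth [::] (tower S T w P) k).
Proof.
elim: w T k => [|j w IH] T [|k] //= /and3P[hj hi hs] hk; first exact: image_tileE.
rewrite -(IH _ k hs hk); apply: eq_imagel => p hp.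
rewrite -iterS iterSr evT_comp (models_rho hD hj)//.
by apply: (includedP hxy hi); rewrite -image_tileE; exists p.
Qed.

Lemma tower_sub T w P Q : stays S T w P -> Q \in tower S T w P ->
  exists2 j, (j < n)%N & tl Q `<=` tl (piece S j).1.
Proof.
elim: w T => [|j w IH] T //= /and3P[hj hi hs]; rewrite inE => /orP[/eqP ->|]; last exact: IH.
by exists j => //; exact: (includedP hxy hi).
Qed.

Lemma tower_iter0 w P k : stays S cid w P -> (k < size w)%N ->
  iter k (rho D) @` tl P = tl (nth [::] (tower S cid w P) k).
Proof. by move=> hs hk; rewrite -(tower_iter hs hk) evT_id. Qed.

Lemma stays_lt T w P k : stays S T w P -> k \in w -> (k < n)%N.
Proof.
by elim: w T => // j w IH T /= /and3P[hj _ hs]; rewrite inE => /orP[/eqP ->|/(IH _ hs)].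
Qed.

Lemma behead_towerP w P Z k : all (fun Q => disjointb Q Z) (behead (tower S cid w P)) ->
  (0 < k < size w)%N -> tl (nth [::] (tower S cid w P) k) `&` tl Z = set0.
Proof.
move=> /allP h /andP[k0 kw]; apply: (disjointbP hxy); apply: h.
case: k k0 kw => // k _; rewrite -(size_tower cid w P).
by case: (tower _ _ _ _) => //= Q Qs; exact: mem_nth.
Qed.

Lemma returnsP Y w P p : returns S Y (w, P) -> tl P p ->
  [/\ tl Y p, first_return D (tl Y) p (size w) & itinerary [seq lb k | k <- w] p].
Proof.
case/and5P => hw hPY hs hd hr hp; split.
- exact: (includedP hxy hPY).
- split; first by rewrite lt0n size_eq0.
    rewrite -[p]/(id p) -(evT_id x y) (stays_iso hs hp); apply: (includedP hxy hr).
    by rewrite -image_tileE; exists p.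
  move=> k hk hY; have /seteqP[+ _] := behead_towerP hd hk.
  move=> /(_ (iter k (rho D) p)); apply; split=> //.
  by have /andP[_ hk'] := hk; rewrite -(tower_iter0 hs hk'); exists p.
- by rewrite -[p]/(id p) -(evT_id x y); apply: stays_itinerary hs hp.
Qed.

Lemma first_return_uniq (A : set (plane R)) p i j :
  first_return D A p i -> first_return D A p j -> i = j.
Proof.
move=> [i0 hi hi'] [j0 hj hj']; have [h|h|//] := ltngtP i j.
  by case: (hj' i); rewrite ?i0.
by case: (hi' j); rewrite ?j0.
Qed.

Lemma itinerary_inj (w w' : seq (lab D)) p : size w = size w' ->
  itinerary w p -> itinerary w' p -> w = w'.
Proof.
elim: w w' p => [|l w IH] [|l' w'] p //= [hsz] [h1 h2] [h1' h2'].
by rewrite (models_lab_inj h1 h1') (IH w' _ hsz h2 h2').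
Qed.

Section Induced.
Variables (Y : ctile) (data : seq (seq nat * ctile)).
Hypothesis hdata : first_return_data S Y data.

Definition word (i : nat) : seq nat := (nth ([::], [::]) data i).1.
Definition base (i : nat) : ctile := (nth ([::], [::]) data i).2.
Definition return_lab (i : nat) : lab (subdomain D (tl Y)) := [seq lb k | k <- word i].

Lemma data_returns i : (i < size data)%N -> returns S Y (word i, base i).
Proof.
move=> hi; have /and4P[/allP h _ _ _] := hdata.
by rewrite /word /base -surjective_pairing; apply: h; apply: mem_nth.
Qed.

Lemma data_stays i : (i < size data)%N -> stays S cid (word i) (base i).
Proof. by move=> /data_returns /and5P[]. Qed.

Lemma return_lab_inj i j : (i < size data)%N -> (j < size data)%N ->
  return_lab i = return_lab j -> i = j.
Proof.
move=> hi hj h; have /and4P[_ _ hu _] := hdata.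
have hw : word i = word j.
  have := data_stays hi; have := data_stays hj; move: h; rewrite /return_lab.
  have hin (w w' : seq nat) : (forall k, k \in w -> (k < n)%N) -> (forall k, k \in w' -> (k < n)%N) ->
      [seq lb k | k <- w] = [seq lb k | k <- w'] -> w = w'.
    elim: w w' => [|k w IH] [|k' w'] //= h1 h2 [hk hw].
    rewrite (models_inj (h1 _ (mem_head _ _)) (h2 _ (mem_head _ _)) hk).
    by rewrite (IH w')// => a ha; [apply: h1|apply: h2]; rewrite inE ha orbT.
  by move=> h hj' hi'; apply: hin h => k; [exact: stays_lt hi'|exact: stays_lt hj'].
apply/eqP; rewrite -(nth_uniq [::] _ _ hu) ?size_map//.
by rewrite !(nth_map ([::], [::]))//; apply/eqP.
Qed.

Lemma return_cover p : tl Y p -> exists2 i, (i < size data)%N & tl (base i) p.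
Proof.
have /and4P[_ hc _ _] := hdata.
move=> /(coveredP hxy hc)[_ /mapP[wP /(nthP ([::], [::]))[i hi <-] ->] hp].
by exists i.
Qed.

(** The cell of a word contains every point with that itinerary. Such a point lies in some listed
    piece, since these cover Y; the word of that piece is the same, and hence so is the piece. *)
Lemma return_cell i : (i < size data)%N -> cell (return_lab i) = tl (base i).
Proof.
move=> hi; apply/seteqP; split=> [p [hY hr ht]|p hp].
  have [j hj hp] := return_cover hY.
  have [_ hr' ht'] := returnsP (data_returns hj) hp.
  have /itinerary_inj h : size (return_lab i) = size (return_lab j).
    by rewrite [in RHS]size_map; apply: first_return_uniq hr hr'.
  by rewrite (return_lab_inj hi hj (h _ ht ht')).
have [h1 h2 h3] := returnsP (data_returns hi) hp.
by split=> //; rewrite size_map.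
Qed.

Lemma models_induced : @models (subdomain D (tl Y)) (induced S Y data) return_lab.
Proof.
have hn i : (i < size (spieces (induced S Y data)))%N = (i < size data)%N by rewrite size_map.
have hp i : (i < size data)%N -> piece (induced S Y data) i = (base i, word_iso S cid (word i)).
  by move=> hi; rewrite /piece (nth_map ([::], [::])).
have hdisj j k p : (j < size data)%N -> (k < size data)%N ->
    tl (base j) p -> tl (base k) p -> j = k.
  move=> hj hk hpj hpk; apply: return_lab_inj => //.
  have [_ h1 h2] := returnsP (data_returns hj) hpj.
  have [_ h1' h2'] := returnsP (data_returns hk) hpk.
  apply: itinerary_inj h2 h2'; rewrite !size_map.
  exact: first_return_uniq h1 h1'.
split=> //.
- by move=> k; rewrite hn => hk; rewrite hp//; exact: return_cell.
- move=> k; rewrite hn => hk; rewrite hp//=.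
  have := stays_iso_word (data_stays hk); rewrite evT_id; exact.
- move=> k p; rewrite hn => hk; rewrite hp//= => hpk.
  have [_ h1 _] := returnsP (data_returns hk) hpk.
  have -> : xget 0%N [set i | first_return D (tl Y) p i] = size (word k).
    case: xgetP => [i _ /first_return_uniq /(_ h1)//|/(_ (size (word k)))].
    by case.
  by have := stays_iso (data_stays hk) hpk; rewrite evT_id.
- move=> l [p [hY hr ht]]; have [i hi hpi] := return_cover hY.
  exists i; rewrite ?hn//; have [_ h1 h2] := returnsP (data_returns hi) hpi.
  apply: itinerary_inj ht h2; rewrite size_map.
  exact: first_return_uniq hr h1.
- move=> j k p; rewrite !hn => hj hk; rewrite !hp//=; exact: hdisj.
- move=> k; rewrite hn => hk; rewrite hp//=; have /and4P[_ _ _ /allP h] := hdata.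
  by apply: (has_interior_neq0 hxy); apply: h; apply: mem_nth.
- move=> p; split=> [/return_cover[i hi hpi]|[i]].
    by exists i; rewrite ?hn// hp.
  by rewrite hn => hi; rewrite hp//= => hpi; have [] := returnsP (data_returns hi) hpi.
Qed.

End Induced.

Lemma periodicP w P : periodic S (w, P) -> periodic_tile D (tl P) (size w).
Proof.
case/and5P => hw hP hs hd /andP[h1 h2].
have hk k : (k < size w)%N -> exists2 j, (j < n)%N & iter k (rho D) @` tl P `<=` tl (piece S j).1.
  by move=> hk; rewrite (tower_iter0 hs hk); apply: (tower_sub hs); rewrite mem_nth ?size_tower.
have w0 : (0 < size w)%N by rewrite lt0n size_eq0.
split.
- exact: (polygonb_polygon hxy).
- have [j hj hjP] := hk 0%N w0; move: hjP; rewrite image_id => hjP.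
  exact: subset_trans hjP (models_atom_sub hj).
- move=> k /hk[j hj hjP]; exists (tl (piece S j).1); split=> //.
  by apply/models_atoms; exists j.
- split=> //.
  have -> : iter (size w) (rho D) @` tl P = evT (word_iso S cid w) @` tl P.
    by apply: eq_imagel => p hp; have := stays_iso hs hp; rewrite evT_id.
  by rewrite image_tileE; apply/seteqP; split; apply: (includedP hxy).
(* The intermediate levels are disjoint from P, so a level equal to P would force P to be empty. *)
- move=> k hk' heq; have := behead_towerP hd hk'.
  have /andP[_ hk''] := hk'; rewrite -(tower_iter0 hs hk'').
  by rewrite heq setIid => /eqP; apply/negP/set0P; apply: (polygonb_neq0 hxy).
Qed.

Lemma periodic_tile_uniq (A : set (plane R)) i j :
  periodic_tile D A i -> periodic_tile D A j -> i = j.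
Proof.
move=> [_ _ _ [i0 hi] hi'] [_ _ _ [j0 hj] hj']; have [h|h|//] := ltngtP i j.
  by case: (hj' i); rewrite ?i0.
by case: (hi' j); rewrite ?j0.
Qed.

End Model.
End Dynamics.

(** * Tilings and areas *)

Section Measure.
Variables (R : realType) (x y : R).
Local Notation tl := (tl x y).
Local Notation T2 := (measurableTypeR R * measurableTypeR R)%type.
Implicit Types (P : ctile).

Lemma measurable_udot m : measurable_fun [set: T2] (fun p : T2 => udot m p : measurableTypeR R).
Proof.
have h1 : measurable_fun [set: T2] (fst : T2 -> measurableTypeR R) by exact: measurable_fst.
have h2 : measurable_fun [set: T2] (snd : T2 -> measurableTypeR R) by exact: measurable_snd.
have hZ (a : R) (f : T2 -> measurableTypeR R) : measurable_fun [set: T2] f ->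
    measurable_fun [set: T2] (fun p => a * f p : measurableTypeR R).
  by move=> hf; apply: measurable_funM => //; exact: measurable_cst.
have hN (f : T2 -> measurableTypeR R) : measurable_fun [set: T2] f ->
    measurable_fun [set: T2] (fun p => - f p : measurableTypeR R).
  by move=> hf; apply: (measurableT_comp (@oppr_measurable R _)).
rewrite /udot; have : (m %% 5 < 5)%N by rewrite ltn_mod.
move: (m %% 5)%N => [|[|[|[|[|k]]]]] //= _.
- by apply: measurable_funD; [exact: hN|exact: hZ].
- by apply: measurable_funB; exact: hZ.
- by apply: measurable_funB => //; exact: hZ.
Qed.

Lemma measurable_tl P : measurable (tl P : set T2).
Proof.
elim: P => [|c P IH].
  by rewrite (_ : tl [::] = setT)//; apply/seteqP; split=> // p _; exact/tlP.
rewrite (_ : tl (c :: P) = [set p | csat x y p c] `&` tl P); last first.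
  by apply/seteqP; split=> p /tl_cons.
apply: measurableI => //.
have hm := measurable_udot c.1.1.
rewrite /csat; case: c.1.2.
  rewrite -[X in measurable X]setTI.
  exact: (hm measurableT [set` `]-oo, ev x y c.2[] (measurable_itv _)).
rewrite -[X in measurable X]setTI.
rewrite (_ : [set p | _] = (fun p : T2 => udot c.1.1 p : measurableTypeR R) @^-1` [set` `[ev x y c.2, +oo[]).
  exact: (hm measurableT _ (measurable_itv _)).
by apply/seteqP; split=> p; rewrite /= in_itv /= andbT.
Qed.

Lemma area_fin_bigcup (I : choiceType) (J : set I) (F : I -> set (plane R)) :
  finite_set J -> trivIset J F ->
  (forall i, J i -> exists P, F i = tl P) ->
  area (\bigcup_(i in J) F i) = (\sum_(i \in J) area (F i))%E.
Proof.
move=> hf ht hm; apply: (@measure_fin_bigcup _ _ T2) => // i /hm[P ->].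
exact: measurable_tl.
Qed.

End Measure.

Notation return_data := (ctile * seq (seq nat * ctile))%type.

(* (inl (i, j, k), Q) for the k-th element Q of the orbit of the j-th piece of the
   i-th induced domain, (inr (j, k), Q) for the k-th element Q of the orbit of the
   j-th periodic tile. *)
Definition labelled_tiles (S : system) (rets : seq return_data)
    (pers : seq (seq nat * ctile)) : seq ((nat * nat * nat + nat * nat) * ctile) :=
  flatten [seq flatten [seq
      let wP := nth ([::], [::]) (nth ([::], [::]) rets i).2 j in
      let t := tower S cid wP.1 wP.2 in
      [seq (inl (i, j, k), nth [::] t k) | k <- iota 0 (size wP.1)]
    | j <- iota 0 (size (nth ([::], [::]) rets i).2)] | i <- iota 0 (size rets)] ++
  flatten [seq
      let wP := nth ([::], [::]) pers j in
      let t := tower S cid wP.1 wP.2 in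
      [seq (inr (j, k), nth [::] t k) | k <- iota 0 (size wP.1)]
    | j <- iota 0 (size pers)].

Definition tilingb (S : system) (rets : seq return_data)
    (pers : seq (seq nat * ctile)) : bool :=
  let ts := labelled_tiles S rets pers in
  [&& all (fun r => first_return_data S r.1 r.2) rets, all (periodic S) pers,
      pairwise (fun a b => disjointb a.2 b.2) ts & covered (sdom S) [seq a.2 | a <- ts]].

Lemma pairwise_mem (T : eqType) (r : rel T) (s : seq T) (a b : T) :
  pairwise r s -> a \in s -> b \in s -> a != b -> r a b || r b a.
Proof.
move=> /(pairwiseP a) h ha hb hab.
rewrite -(nth_index a ha) -(nth_index a hb).
have [hlt|hlt|heq] := ltngtP (index a s) (index b s).
- by rewrite h ?inE ?index_mem.
- by rewrite orbC h ?inE ?index_mem.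
- by move: hab; rewrite -(nth_index a ha) heq (nth_index a hb) eqxx.
Qed.

Section Tiling.
Variables (R : realType) (x y : R).
Hypothesis hxy : parameters x y.
Local Notation tl := (tl x y).
Implicit Types (P Q Y : ctile) (w : seq nat).
Variables (D : dressed R) (S : system) (lb : nat -> lab D).
Hypothesis hD : models x y S lb.
Variables (rets : seq return_data) (pers : seq (seq nat * ctile)).
Hypothesis htiling : tilingb S rets pers.

Local Notation Ys := [seq tl r.1 | r <- rets].
Local Notation Ps := [seq tl wP.2 | wP <- pers].
Local Notation ret i := (nth ([::], [::]) rets i).
Local Notation per j := (nth ([::], [::]) pers j).
Local Notation ts := (labelled_tiles S rets pers).

(** Certificates number the pieces of an induced domain, whereas [orbit_index] names them by their
    words. *)
Definition decode (a : nat * nat * nat + nat * nat) : nat * seq (lab D) * nat + nat * nat :=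
  match a with
  | inl (i, j, k) => inl (i, [seq lb l | l <- word (ret i).2 j], k)
  | inr (j, k) => inr (j, k)
  end.

Lemma ret_first i : (i < size rets)%N -> first_return_data S (ret i).1 (ret i).2.
Proof. by move=> hi; have /and4P[/allP h _ _ _] := htiling; apply: h; apply: mem_nth. Qed.

Lemma per_periodic j : (j < size pers)%N -> periodic S ((per j).1, (per j).2).
Proof.
move=> hj; have /and4P[_ /allP h _ _] := htiling; rewrite -surjective_pairing.
by apply: h; apply: mem_nth.
Qed.

Lemma orbit_member_ret i j k : (i < size rets)%N -> (j < size (ret i).2)%N ->
  (k < size (word (ret i).2 j))%N ->
  orbit_member Ys Ps (decode (inl (i, j, k))) =
  tl (nth [::] (tower S cid (word (ret i).2 j) (base (ret i).2 j)) k).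
Proof.
move=> hi hj hk; have hf := ret_first hi; rewrite /orbit_member /decode.
rewrite (nth_map ([::], [::]))//.
have := return_cell hxy hD hf hj; rewrite /return_lab => ->.
exact: (tower_iter0 hxy hD (data_stays hf hj) hk).
Qed.

Lemma orbit_member_per j k : (j < size pers)%N -> (k < size (per j).1)%N ->
  orbit_member Ys Ps (decode (inr (j, k))) = tl (nth [::] (tower S cid (per j).1 (per j).2) k).
Proof.
move=> hj hk; rewrite /orbit_member /= (nth_map ([::], [::]))//.
by have /and5P[_ _ hs _ _] := per_periodic hj; exact: (tower_iter0 hxy hD hs hk).
Qed.

Lemma labelled_tilesP a Q : (a, Q) \in ts ->
  [/\ @orbit_index R D Ys Ps (decode a), orbit_member Ys Ps (decode a) = tl Q
    & tl Q `<=` dom D].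
Proof.
rewrite mem_cat => /orP[/flatten_mapP[i]|/flatten_mapP[j]]; rewrite mem_iota /= add0n => h.
  case/flatten_mapP => j; rewrite mem_iota add0n /= => hj.
  case/mapP => k; rewrite mem_iota add0n /= => hk [-> ->].
  rewrite orbit_member_ret//; split=> //; first by rewrite /orbit_index /= !size_map.
  have [l hl hs] : exists2 l, (l < size (spieces S))%N &
      tl (nth [::] (tower S cid (word (ret i).2 j) (base (ret i).2 j)) k) `<=` tl (piece S l).1.
    by apply: (tower_sub hxy (data_stays (ret_first h) hj)); rewrite mem_nth ?size_tower.
  exact: subset_trans hs (models_atom_sub hD hl).
case/mapP => k; rewrite mem_iota add0n /= => hk [-> ->].
have hp := per_periodic h; rewrite orbit_member_per//; split=> //.
  rewrite /orbit_index /= size_map; split=> //; exists (size (per j).1); split=> //.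
  by rewrite (nth_map ([::], [::]))//; exact: (periodicP hxy hD hp).
have [l hl hs] : exists2 l, (l < size (spieces S))%N &
    tl (nth [::] (tower S cid (per j).1 (per j).2) k) `<=` tl (piece S l).1.
  by have /and5P[_ _ hs _ _] := hp; apply: (tower_sub hxy hs); rewrite mem_nth ?size_tower.
exact: subset_trans hs (models_atom_sub hD hl).
Qed.

Lemma orbit_member_labelled a : @orbit_index R D Ys Ps a -> orbit_member Ys Ps a !=set0 ->
  exists2 bQ, bQ \in ts & a = decode bQ.1.
Proof.
case: a => [[[i w] k] /= [hi hk] [q [p hp _]]|[j k] /= [hj [m [hm hk]]] _].
  rewrite size_map in hi; have hf := ret_first hi; move: hp; rewrite (nth_map ([::], [::]))// => hp.
  have [l hl ew] : exists2 l, (l < size (spieces (induced S (ret i).1 (ret i).2)))%N &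
      w = return_lab x y lb (ret i).1 (ret i).2 l.
    by apply: (models_lab (models_induced hxy hD hf)); exists p.
  rewrite size_map in hl; rewrite ew size_map in hk.
  exists (inl (i, l, k), nth [::] (tower S cid (word (ret i).2 l) (base (ret i).2 l)) k); last by rewrite ew.
  rewrite mem_cat; apply/orP; left; apply/flatten_mapP; exists i; first by rewrite mem_iota.
  apply/flatten_mapP; exists l; first by rewrite mem_iota.
  by apply/mapP; exists k; rewrite ?mem_iota.
rewrite size_map in hj; have hp := per_periodic hj.
move: hm; rewrite (nth_map ([::], [::]))// => /periodic_tile_uniq /(_ (periodicP hxy hD hp)) em.
exists (inr (j, k), nth [::] (tower S cid (per j).1 (per j).2) k) => //.
rewrite mem_cat; apply/orP; right; apply/flatten_mapP; exists j; first by rewrite mem_iota.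
by apply/mapP; exists k; rewrite ?mem_iota// -em.
Qed.

(** The index set is infinite, as any word may occur in it, but an unrealized word gives the empty
    set, of area 0. The sum thus reduces to the finite set J of nonempty members, where additivity
    turns it into the area of a union that the covering certificate identifies with the domain. *)
Lemma tiled_by_orbitsP : tiled_by_orbits D Ys Ps.
Proof.
have sub a : @orbit_index R D Ys Ps a -> orbit_member Ys Ps a `<=` dom D.
  move=> ha q hq; have [[b Q] hb ea] := orbit_member_labelled ha (ex_intro _ q hq).
  by have [_ h1 h2] := labelled_tilesP hb; apply: h2; rewrite -h1 -ea.
have triv : trivIset (@orbit_index R D Ys Ps) (orbit_member Ys Ps).
  move=> a a' ha ha' [q [hq hq']].
  have [[b Q] hb ea] := orbit_member_labelled ha (ex_intro _ q hq).
  have [[b' Q'] hb' ea'] := orbit_member_labelled ha' (ex_intro _ q hq').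
  have [_ h1 _] := labelled_tilesP hb; have [_ h1' _] := labelled_tilesP hb'.
  rewrite ea ea'; have [[-> //]|hne] := eqVneq (b, Q) (b', Q').
  have /and4P[_ _ hpw _] := htiling.
  move: hq hq'; rewrite ea ea' h1 h1' => hq hq'.
  by case/orP: (pairwise_mem hpw hb hb' hne) => /= /(disjointbP hxy)/seteqP[+ _] => /(_ q)[].
split=> //.
pose J := [set a | @orbit_index R D Ys Ps a /\ orbit_member Ys Ps a !=set0].
have J_fin : finite_set J.
  apply: (@sub_finite_set _ _ ((fun bQ => decode bQ.1) @` [set` ts])).
    by move=> a [h1 h2]; have [bQ hbQ ->] := orbit_member_labelled h1 h2; exists bQ.
  exact: finite_image.
have -> : (\esum_(a in @orbit_index R D Ys Ps) area (orbit_member Ys Ps a) =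
    \esum_(a in J) area (orbit_member Ys Ps a))%E.
  rewrite esum_mkcond [RHS]esum_mkcond; apply: eq_esum => a _.
  have [/set0P ha|/negPn/eqP ha] := boolP (orbit_member Ys Ps a != set0); last first.
    by rewrite ha /area measure0 !if_same.
  by congr (if _ then _ else _); apply/idP/idP; rewrite !inE; [|case].
rewrite esum_fset//.
rewrite -(area_fin_bigcup (x := x) (y := y)) //; first congr area.
- apply/seteqP; split=> [q [a [ha _] hq]|q]; first exact: sub ha _ hq.
  rewrite (models_dom hD); have /and4P[_ _ _ hc] := htiling.
  move=> /(coveredP hxy hc)[_ /mapP[[b Q] hb ->] hq].
  have [h1 h2 _] := labelled_tilesP hb.
  have hq' : orbit_member Ys Ps (decode b) q by rewrite h2.
  by exists (decode b) => //; split=> //; exists q.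
- by apply: sub_trivIset triv => a [].
- move=> a [h1 h2]; have [[b Q] hb ->] := orbit_member_labelled h1 h2.
  by have [_ -> _] := labelled_tilesP hb; exists Q.
Qed.

End Tiling.

(** * Merged atoms and similarity *)

Definition partitionb (S : system) : bool :=
  let Ps := [seq PT.1 | PT <- spieces S] in
  [&& pairwise disjointb Ps, covered (sdom S) Ps,
      all (fun P => included P (sdom S)) Ps & all has_interior Ps].

(** By convexity, two distinct vertices of P in the closed polygon of Q span a common segment. The
    interiors guarantee that the closed polygons are the closures of the half-open tiles. *)
Definition adjacentb (P Q : ctile) : bool :=
  let vs := [seq p <- vertices P | in_closed Q p] in
  [&& has_interior P, has_interior Q &
      has (fun p => has (fun q => agt0 (aadd p.1 (aopp q.1)) || agt0 (aadd p.2 (aopp q.2))) vs) vs].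

(** The isometries must differ at every parameter, hence the demand for different rotations or for a
    translation component whose difference has constant sign. *)
Definition iso_neqb (T T' : ciso) : bool :=
  [|| T.2 %% 5 != T'.2 %% 5,
      agt0 (aadd T.1.1 (aopp T'.1.1)), agt0 (aadd T'.1.1 (aopp T.1.1)),
      agt0 (aadd T.1.2 (aopp T'.1.2)) | agt0 (aadd T'.1.2 (aopp T.1.2))]%N.

(* ([:: h, k1, ..], M) : the pieces k1, .. are adjacent to the piece h, carry the
   same isometry, and merge with it into M. *)
Notation group := (seq nat * ctile)%type.

Definition groupb (S : system) (g : group) : bool :=
  let P k := (piece S k).1 in
  [&& 0 < size g.1, all (fun k => k < size (spieces S)) g.1,
      all (fun k => (piece S k).2 == (piece S (head 0 g.1)).2) g.1,
      all (fun k => adjacentb (P (head 0 g.1)) (P k)) (behead g.1),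
      covered g.2 [seq P k | k <- g.1] & all (fun k => included (P k) g.2) g.1]%N.

(** Within a group all pieces are linked through its head. Merging preserves the isometry, and
    different groups have different isometries, so no chain of mergeable pieces leaves a group. *)
Definition mergeb (S : system) (gs : seq group) : bool :=
  [&& all (groupb S) gs,
      all (fun k => has (fun g : group => k \in g.1) gs) (iota 0 (size (spieces S)))
    & pairwise (fun g h : group => iso_neqb (piece S (head 0%N g.1)).2 (piece S (head 0%N h.1)).2) gs].

Section Merge.
Variables (R : realType) (x y : R).
Hypothesis hxy : parameters x y.
Local Notation tl := (tl x y).
Local Notation evT := (evT x y).
Implicit Types (P Q Y : ctile) (S : system).

Lemma models_of_pieces S n (X : set (plane R)) (A : 'I_n.+1 -> set (plane R))
    (f : 'I_n.+1 -> plane R -> plane R) :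
  size (spieces S) = n.+1 -> X = tl (sdom S) ->
  (forall k : 'I_n.+1, A k = tl (piece S k).1) ->
  (forall k : 'I_n.+1, f k = evT (piece S k).2) ->
  partitionb S -> @models R x y (of_pieces X A f) S (fun k => inord k).
Proof.
move=> hn hX hA hf /and4P[hd hc /allP hi /allP hz].
have pieceE k : (k < n.+1)%N -> (piece S k).1 = nth [::] [seq PT.1 | PT <- spieces S] k.
  by move=> hk; rewrite (nth_map ([::], cid))// hn.
have memP k : (k < n.+1)%N -> (piece S k).1 \in [seq PT.1 | PT <- spieces S].
  by move=> hk; rewrite pieceE// mem_nth ?size_map ?hn.
have hdisj j k p : (j < n.+1)%N -> (k < n.+1)%N -> tl (piece S j).1 p -> tl (piece S k).1 p -> j = k.
  wlog jk : j k / (j < k)%N.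
    by move=> h hj hk h1 h2; have [/h|/h h'|//] := ltngtP j k; [apply|rewrite h'].
  move=> hj hk; rewrite !pieceE// => h1 h2.
  have /(disjointbP hxy)/seteqP[+ _] : disjointb (nth [::] [seq PT.1 | PT <- spieces S] j)
      (nth [::] [seq PT.1 | PT <- spieces S] k).
    by move/(pairwiseP [::]): hd; apply=> //; rewrite inE size_map hn.
  by move=> /(_ p)[].
split; rewrite ?hn //.
- by move=> k hk /=; rewrite hA inordK.
- by move=> k hk /=; rewrite hf inordK.
- move=> k p hk hp /=; case: pickP => [j /asboolP|/(_ (inord k))].
    by rewrite hA hf => hj; rewrite (hdisj _ _ _ (ltn_ord j) hk hj hp).
  by rewrite hA inordK// asboolT.
- by move=> l _; exists l; rewrite ?inord_val.
- by move=> k hk; apply/(has_interior_neq0 hxy)/hz/memP.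
- move=> p /=; rewrite hX; split=> [/(coveredP hxy hc)[P /(nthP [::])[k]]|[k hk hkp]].
    by rewrite size_map hn => hk <-; rewrite -pieceE//; exists k.
  by apply: (includedP hxy _ hkp); apply: hi; exact: memP.
Qed.

Lemma adjacentP P Q : adjacentb P Q -> Defs.adjacent (tl P) (tl Q).
Proof.
case/and3P => /(has_interiorP hxy)[z hz] /(has_interiorP hxy)[z' hz'].
case/hasP => p + /hasP[q]; rewrite !mem_filter => /andP[pQ /andP[pP _]] /andP[qQ /andP[qP _]] hpq.
exists (evp x y p), (evp x y q); split.
  apply/negP => /eqP[e1 e2].
  by case/orP: hpq => /(agt0P hxy); rewrite ev_add ev_opp ?e1 ?e2 subrr ltxx.
move=> l /andP[l0 l1].
have -> : evp x y p + l *: (evp x y q - evp x y p) =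
    ((1 - l) * (evp x y p).1 + l * (evp x y q).1, (1 - l) * (evp x y p).2 + l * (evp x y q).2).
  by congr (_, _); rewrite /= /GRing.scale /=; ring.
have {}l1 : 0 <= 1 - l by rewrite subr_ge0.
split; [apply: (closure_tl hz)|apply: (closure_tl hz')] => c hc; rewrite rslack_convex.
  by rewrite addr_ge0// mulr_ge0//; apply: (in_closedP hxy _ hc).
by rewrite addr_ge0// mulr_ge0//; apply: (in_closedP hxy _ hc).
Qed.

Lemma adjacentC (A B : set (plane R)) : Defs.adjacent A B -> Defs.adjacent B A.
Proof. by move=> [p [q [hpq h]]]; exists p, q; split=> // l /h; rewrite setIC. Qed.

Lemma rotR_inj m n : (m < 5)%N -> (n < 5)%N ->
  (forall p : plane R, rotR m p = rotR n p) -> m = n.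
Proof.
have b0 := beta_gt0 R; have b1 := beta_lt1 R.
(* The five rotations send (1, 0) to points with second coordinates 0, 1, beta, - beta, -1, which
   are distinct. *)
have h2 := beta_sqr R; move=> hm hn /(_ (1, 0))/(congr1 snd).
by move: m n hm hn => [|[|[|[|[|m]]]]] [|[|[|[|[|n]]]]] //= _ _; rewrite ?/rot1 /= => h;
  exfalso; nra.
Qed.

Lemma iso_neqP T T' : iso_neqb T T' -> evT T <> evT T'.
Proof.
move=> h e; have e0 : evp x y T.1 = evp x y T'.1.
  have r0 k : rotR k (0, 0) = (0, 0) :> plane R.
    by elim: k => //= k ->; rewrite /rot1 /= mulr0 subr0.
  by have := congr1 (fun f => f (0, 0)) e; rewrite /evT /TR /= !r0 /trans /= !add0r.
case/or4P: h => [/eqP|||/orP[]].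
- apply; apply: rotR_inj; rewrite ?ltn_mod// => p; rewrite !rotR_mod.
  have := congr1 (fun f => f p) e; rewrite /evT /TR /= e0 /trans => -[/addIr h1 /addIr h2].
  by rewrite [LHS]surjective_pairing h1 h2 -surjective_pairing.
all: by move/(agt0P hxy); rewrite ev_add ev_opp; case: e0 => e1 e2; rewrite ?e1 ?e2 subrr ltxx.
Qed.

Section Atoms.
Variables (D : dressed R) (S : system) (lb : nat -> lab D).
Hypothesis hD : models x y S lb.
Variable gs : seq group.
Hypothesis hgs : mergeb S gs.
Local Notation n := (size (spieces S)).

Lemma groupP g : g \in gs -> groupb S g.
Proof. by have /and3P[/allP h _ _] := hgs; exact: h. Qed.

Lemma group_lt g k : g \in gs -> k \in g.1 -> (k < n)%N.
Proof. by move=> /groupP/and5P[_ /allP h _ _ _]; exact: h. Qed.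

Lemma group_iso g k : g \in gs -> k \in g.1 -> (piece S k).2 = (piece S (head 0%N g.1)).2.
Proof. by move=> /groupP/and5P[_ _ /allP h _ _] /h/eqP. Qed.

Lemma group_head g : g \in gs -> head 0%N g.1 \in g.1.
Proof. by move=> /groupP/and5P[]; case: g.1 => //= a l _ _ _ _ _; rewrite mem_head. Qed.

Lemma group_ex k : (k < n)%N -> exists2 g, g \in gs & k \in g.1.
Proof. by have /and3P[_ /allP h _] := hgs; move=> hk; apply/hasP/h; rewrite mem_iota. Qed.

Lemma group_tl g p : g \in gs -> tl g.2 p <-> exists2 k, k \in g.1 & tl (piece S k).1 p.
Proof.
move=> /groupP/and5P[_ _ _ _ /andP[hc /allP hi]]; split=> [|[k /hi h]].
  by move=> /(coveredP hxy hc)[_ /mapP[k hk ->] hp]; exists k.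
exact: (includedP hxy h).
Qed.

Lemma group_eq g h k l : g \in gs -> h \in gs -> k \in g.1 -> l \in h.1 ->
  evT (piece S k).2 = evT (piece S l).2 -> g = h.
Proof.
move=> hg hh hk hl; rewrite (group_iso hg hk) (group_iso hh hl) => he.
have [//|hne] := eqVneq g h; have /and3P[_ _ hpw] := hgs.
by case/orP: (pairwise_mem hpw hg hh hne) => /iso_neqP []; rewrite he.
Qed.

Lemma mergeable_neq0 (j k : lab D) : mergeable j k -> cell j !=set0 /\ cell k !=set0.
Proof.
case=> _ [p [q [_ h]]]; have [] := h 0; first by rewrite lexx ler01.
rewrite scale0r addr0 => h1 h2.
by split; apply/set0P/eqP => e; move: h1 h2; rewrite e closure0.
Qed.

Lemma reachable_iso (j k : lab D) : clos_refl_trans _ (@mergeable R D) j k ->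
  cell j !=set0 -> cell k !=set0 /\ iso j = iso k.
Proof.
elim=> {j k} [j k h hj|//|i j k _ IH1 _ IH2 hi].
  by have [_ hk] := mergeable_neq0 h; case: h.
by have [hj ->] := IH1 hi; exact: IH2.
Qed.

(** An empty cell has empty closure, so it is adjacent to nothing and forms a merging class
    alone. *)
Lemma unreachable (j k : lab D) : clos_refl_trans _ (@mergeable R D) j k ->
  ~ (cell j !=set0) -> k = j.
Proof.
elim=> {j k} [j k /mergeable_neq0[h _] hj|//|i j k _ IH1 _ IH2 hi]; first by case: hj.
by have ej := IH1 hi; rewrite (IH2 _) ?ej.
Qed.

Lemma reachable_group g j k : g \in gs -> j \in g.1 -> k \in g.1 ->
  clos_refl_trans _ (@mergeable R D) (lb j) (lb k).
Proof.
move=> hg hj hk; pose h := head 0%N g.1; have hh : h \in g.1 := group_head hg.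
have hadj i : i \in g.1 -> i = h \/ Defs.adjacent (tl (piece S h).1) (tl (piece S i).1).
  have /and5P[_ _ _ /allP ha _] := groupP hg; move=> hi.
  have : i \in head 0%N g.1 :: behead g.1 by move: hi; case: g.1.
  by rewrite inE => /orP[/eqP ->|/ha/adjacentP]; [left|right].
have hiso i : i \in g.1 -> iso (lb i) = iso (lb h).
  move=> hi; rewrite !(models_iso hD) ?(group_lt hg)//.
  by rewrite (group_iso hg hi).
have hcell i : i \in g.1 -> cell (lb i) = tl (piece S i).1.
  by move=> hi; rewrite (models_cell hD) ?(group_lt hg).
apply: (@rt_trans _ _ _ (lb h)).
  have [->|ha] := hadj _ hj; first exact: rt_refl.
  by apply: rt_step; split; [exact: hiso|rewrite !hcell//; exact: adjacentC].
have [->|ha] := hadj _ hk; first exact: rt_refl.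
by apply: rt_step; split; [rewrite hiso|rewrite !hcell].
Qed.

Lemma merged_cell g k : g \in gs -> k \in g.1 -> cell (lb k : lab (merge_atoms D)) = tl g.2.
Proof.
move=> hg hk; have hkn := group_lt hg hk.
have nk : cell (lb k) !=set0 by rewrite (models_cell hD hkn); exact: (models_neq0 hD).
apply/seteqP; split=> p.
  case=> l /reachable_iso /(_ nk)[hl hiso] hp.
  have [j hj ej] := models_lab hD hl; subst l; have [h hh hjh] := group_ex hj.
  have e : g = h.
    by apply: (group_eq hg hh hk hjh); rewrite -!(models_iso hD).
  by apply/(group_tl _ hg); exists j; rewrite ?e// -(models_cell hD).
move=> /(group_tl _ hg)[j hj hp]; exists (lb j); first exact: reachable_group hg hk hj.
by rewrite (models_cell hD) ?(group_lt hg).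
Qed.

Lemma merged_atoms (A : set (plane R)) :
  atoms (merge_atoms D) A <-> exists2 g, g \in gs & A = tl g.2.
Proof.
split=> [[l [-> [p hp]]]|[g hg ->]].
  have hl : cell (l : lab D) !=set0.
    apply: contrapT => hn; case: hp => k hk hp.
    by have ek := unreachable hk hn; apply: hn; exists p; rewrite -ek.
  have [k hk ek] := models_lab hD hl; subst l; have [g hg hkg] := group_ex hk.
  by exists g => //; exact: merged_cell.
have hh := group_head hg; exists (lb (head 0%N g.1)); rewrite (merged_cell hg hh); split=> //.
have [p hp] := models_neq0 hD (group_lt hg hh).
by exists p; apply/(group_tl _ hg); exists (head 0%N g.1).
Qed.

End Atoms.
End Merge.

(* p |-> scale * rot^turns (flip p) + shift *)
Record gauge := Gauge { scale : Zw; flip : bool; turns : nat; shift : cpoint }.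

Definition gapply (g : gauge) (p : cpoint) : cpoint :=
  let p1 : cpoint := if flip g then (p.1, aadd (ascale wbe p.1) (aopp p.2)) else p in
  let p2 := iter (turns g) crot1 p1 in
  cadd (ascale (scale g) p2.1, ascale (scale g) p2.2) (shift g).

(** The reflection [refl0] exchanges u_m and u_(-m), whence the index 5 - m. *)
Definition gimage (g : gauge) (P : ctile) : ctile :=
  [seq let m := (((if flip g then 5 - c.1.1 %% 5 else c.1.1) + turns g) %% 5)%N in
       (m, c.1.2, aadd (ascale (scale g) c.2) (cdot m (shift g))) | c <- P].

Definition eq_tileb (P Q : ctile) : bool := included P Q && included Q P.

(* Two affine maps agree as soon as they agree at three points. *)
Definition conjugateb (g : gauge) (T T' : ciso) : bool :=
  all (fun p => capply T' (gapply g p) == gapply g (capply T p))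
    [:: (a0, a0); (acst w1, a0); (a0, acst w1)].

Definition similarb (S : system) (gs : seq group) (S' : system) (g : gauge) : bool :=
  [&& wgt0 (scale g), eq_tileb (gimage g (sdom S)) (sdom S'),
      size gs == size (spieces S') &
      all (fun i => let gr := nth ([::], [::]) gs i in
             eq_tileb (gimage g gr.2) (piece S' i).1 &&
             conjugateb g (piece S (head 0%N gr.1)).2 (piece S' i).2)
          (iota 0 (size gs))].

Section Similar.
Variables (R : realType) (x y : R).
Hypothesis hxy : parameters x y.
Local Notation tl := (tl x y).
Local Notation evT := (evT x y).
Local Notation evp := (evp x y).

Definition homothety (a : R) (p : plane R) : plane R := (a * p.1, a * p.2).

Definition evG (g : gauge) : plane R -> plane R :=
  trans (evp (shift g)) \o homothety (wR R (scale g)) \o rotR (turns g) \o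
  (if flip g then @refl0 R else id).

Lemma evp_gapply g p : evp (gapply g p) = evG g (evp p).
Proof.
rewrite /evG /= -[X in rotR _ X](_ : evp (if flip g then (p.1, aadd (ascale wbe p.1) (aopp p.2)) else p) = _).
  by rewrite -evp_rot evp_add /homothety /evp /= !ev_scale.
by case: (flip g) => //; rewrite /evp /refl0 /= ev_add ev_scale ev_opp wRbe.
Qed.

Lemma frakG_evG g : wgt0 (scale g) -> frakG (evG g).
Proof.
move=> /(wR_gt0 R) h; apply: frakG_comp; last by case: ifP => _; [exact: frakG_refl|exact: frakG_id].
apply: frakG_comp; last first.
  elim: (turns g) => [|n IH]; first exact: frakG_id.
  exact: (frakG_comp (frakG_rot R) IH).
by apply: frakG_comp; [exact: frakG_trans|exact: frakG_homothety].
Qed.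

Lemma frakG_bij (f : plane R -> plane R) : frakG f -> bijective f.
Proof.
elim=> {f}.
- by exists (@rot1_inv R); [exact: rot1K|exact: rot1_invK].
- by exists (@refl0 R) => -[a b]; rewrite /refl0 /=; congr (_, _); ring.
- by move=> d; exact: (TR_bij d 0).
- move=> eta heta; exists (fun p => (eta^-1 * p.1, eta^-1 * p.2)) => -[a b] /=;
    by rewrite ?mulKf ?mulVKf ?lt0r_neq0.
- by exists id.
- by move=> g h _ hg _ hh; exact: bij_comp.
- by move=> g h _ _ gh hg; exists g.
Qed.

Lemma udot_refl0 m (p : plane R) : udot (5 - m %% 5) (refl0 p) = udot m p.
Proof.
rewrite /udot /refl0 /=; have : (m %% 5 < 5)%N by rewrite ltn_mod.
have hb := beta_sqr R.
have h1 : beta ^+ 2 * p.1 = p.1 - beta * p.1 by rewrite hb; ring.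
by move: (m %% 5)%N => [|[|[|[|[|k]]]]] //= _; lra.
Qed.

Lemma gimageP g P p : wgt0 (scale g) -> tl (gimage g P) (evG g p) <-> tl P p.
Proof.
move=> /(wR_gt0 R) hs.
have hm (c : constr) : let m := (((if flip g then 5 - c.1.1 %% 5 else c.1.1) + turns g) %% 5)%N in
    csat x y (evG g p) (m, c.1.2, aadd (ascale (scale g) c.2) (cdot m (shift g))) <-> csat x y p c.
  rewrite /csat /= ev_add ev_scale ev_cdot !udot_mod /evG /= /trans udotD udotZ udot_rotR.
  have -> : udot (if flip g then (5 - c.1.1 %% 5)%N else c.1.1) ((if flip g then @refl0 R else id) p) = udot c.1.1 p.
    by case: (flip g) => //; exact: udot_refl0.
  by case: c.1.2; rewrite ?lerD2r ?ltrD2r ?ler_pM2l ?ltr_pM2l.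
split=> /tlP h; apply/tlP => c.
  by move=> hc; apply/hm; apply: h; apply/mapP; exists c.
by case/mapP => d hd ->; apply/hm/h.
Qed.

Lemma gimageE g P : wgt0 (scale g) -> evG g @` tl P = tl (gimage g P).
Proof.
move=> hs; apply/seteqP; split=> [_ [p hp <-]|p hp]; first exact/gimageP.
have [h _ hK] := frakG_bij (frakG_evG hs).
by exists (h p); [apply/(gimageP _ _ hs); rewrite hK|rewrite hK].
Qed.

Definition affine (f : plane R -> plane R) : Prop :=
  exists a b c a' b' c', forall p, f p = (a * p.1 + b * p.2 + c, a' * p.1 + b' * p.2 + c').

Lemma affine_comp f g : affine f -> affine g -> affine (f \o g).
Proof.
move=> [a [b [c [a' [b' [c' hf]]]]]] [d [e [h [d' [e' [h' hg]]]]]].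
exists (a * d + b * d'), (a * e + b * e'), (a * h + b * h' + c),
  (a' * d + b' * d'), (a' * e + b' * e'), (a' * h + b' * h' + c') => p /=.
by rewrite hf hg /=; congr (_, _); ring.
Qed.

Lemma affine_id : affine id.
Proof.
exists 1, 0, 0, 0, 1, 0 => -[a b] /=.
by rewrite !mul0r !mul1r !addr0 add0r.
Qed.

Lemma affine_rotR n : affine (rotR n).
Proof.
elim: n => [|n IH]; first exact: affine_id.
apply: (@affine_comp (@rot1 R) (rotR n)) => //.
exists beta, (-1), 0, 1, 0, 0 => -[a b] /=.
by rewrite /rot1 /=; congr (_, _); ring.
Qed.

Lemma affine_trans d : affine (trans d).
Proof. by exists 1, 0, d.1, 0, 1, d.2 => -[a b]; rewrite /trans /=; congr (_, _); ring. Qed.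

Lemma affine_evT T : affine (evT T).
Proof. by apply: affine_comp; [exact: affine_trans|exact: affine_rotR]. Qed.

Lemma affine_evG g : affine (evG g).
Proof.
apply: affine_comp; last first.
  case: (flip g); last exact: affine_id.
  by exists 1, 0, 0, beta, (-1), 0 => -[a b]; rewrite /refl0 /=; congr (_, _); ring.
apply: affine_comp; last exact: affine_rotR.
apply: affine_comp; first exact: affine_trans.
set e := wR _ _.
by exists e, 0, 0, 0, e, 0 => -[a b]; rewrite /homothety /=; congr (_, _); ring.
Qed.

Lemma affine_eq f g : affine f -> affine g ->
  f (0, 0) = g (0, 0) -> f (1, 0) = g (1, 0) -> f (0, 1) = g (0, 1) -> f =1 g.
Proof.
move=> [a [b [c [a' [b' [c' hf]]]]]] [d [e [h [d' [e' [h' hg]]]]]].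
rewrite !hf !hg /= => -[h1 h2] [h3 h4] [h5 h6] p; rewrite hf hg.
have e1 : c = h by lra.
have e2 : c' = h' by lra.
have e3 : a = d by lra.
have e4 : a' = d' by lra.
have e5 : b = e by lra.
have e6 : b' = e' by lra.
by rewrite e1 e2 e3 e4 e5 e6.
Qed.

Lemma conjugateP g T T' : conjugateb g T T' -> evT T' \o evG g =1 evG g \o evT T.
Proof.
case/and4P => /eqP h1 /eqP h2 /eqP h3 _.
have e1 : ev x y (acst w1) = 1 by rewrite ev_cst wR1.
have e p : capply T' (gapply g p) = gapply g (capply T p) ->
    (evT T' \o evG g) (evp p) = (evG g \o evT T) (evp p).
  by move=> /(congr1 evp); rewrite evp_apply !evp_gapply evp_apply.
apply: affine_eq; try by apply: affine_comp; (exact: affine_evT || exact: affine_evG).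
- by have := e _ h1; rewrite /evp /= ev0.
- by have := e _ h2; rewrite /evp /= ev0 e1.
- by have := e _ h3; rewrite /evp /= ev0 e1.
Qed.

Lemma eq_tileP P Q : eq_tileb P Q -> tl P = tl Q.
Proof. by case/andP => h1 h2; apply/seteqP; split; apply: (includedP hxy). Qed.

Lemma similar_merged (D E : dressed R) (S S' : system) lb lb' gs g :
  models x y S (lb : nat -> lab D) -> models x y S' (lb' : nat -> lab E) ->
  mergeb S gs -> similarb S gs S' g -> similar_dressed (merge_atoms D) E.
Proof.
move=> hD hE hgs /and4P[hs /eq_tileP hdom /eqP hsz /allP hall].
have hi i : (i < size gs)%N -> evG g @` tl (nth ([::], [::]) gs i).2 = tl (piece S' i).1 /\
    evT (piece S' i).2 \o evG g =1 evG g \o evT (piece S (head 0%N (nth ([::], [::]) gs i).1)).2.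
  move=> hi; have /hall/andP[/eq_tileP h1 /conjugateP h2] : i \in iota 0 (size gs) by rewrite mem_iota.
  by rewrite gimageE.
exists (evG g); split.
- exact: frakG_evG.
- by rewrite /= (models_dom hD) gimageE// hdom (models_dom hE).
- apply/seteqP; split=> A.
    case=> B /(merged_atoms hxy hD hgs)[gr /(nthP ([::], [::]))[i hin <-] ->] <-.
    by have [-> _] := hi i hin; apply/(models_atoms hE); exists i; rewrite -?hsz.
  move=> /(models_atoms hE)[i]; rewrite -hsz => hin ->; have [<- _] := hi i hin.
  exists (tl (nth ([::], [::]) gs i).2) => //.
  by apply/(merged_atoms hxy hD hgs); exists (nth ([::], [::]) gs i) => //; exact: mem_nth.
- move=> p /= /(models_cover hD)[k hk hkp].
  have [gr hgr hkgr] := group_ex hgs hk.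
  have /(nthP ([::], [::]))[i hin ei] := hgr.
  have [h1 h2] := hi i hin.
  rewrite (models_rho hD hk hkp) (group_iso hgs hgr hkgr) -ei -[RHS]h2.
  apply: (models_rho hE); first by rewrite -hsz.
  rewrite -h1; exists p => //; rewrite ei.
  by apply/(group_tl hxy hgs _ hgr); exists k.
Qed.

End Similar.

(** * The renormalization function on Q(sqrt 5) *)

Section QuadraticField.
Variable R : realType.
Local Notation omega := (@omega R).
Local Notation beta := (@beta R).
Local Notation Qs := (@in_Qsqrt5 R).
Implicit Types u v : R.

Lemma Qs_rat (r : rat) : Qs (ratr r).
Proof. by exists r, 0; rewrite rmorph0 mul0r addr0. Qed.

Lemma Qs_int (n : int) : Qs n%:~R.
Proof. by have := Qs_rat n%:~R; rewrite rmorph_int. Qed.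

Lemma Qs_nat (n : nat) : Qs n%:R. Proof. exact: Qs_int n. Qed.

Lemma QsD u v : Qs u -> Qs v -> Qs (u + v).
Proof.
move=> [p [q ->]] [p' [q' ->]]; exists (p + p'), (q + q').
by rewrite !rmorphD /=; ring.
Qed.

Lemma QsN u : Qs u -> Qs (- u).
Proof. by move=> [p [q ->]]; exists (- p), (- q); rewrite !rmorphN /=; ring. Qed.

Lemma QsB u v : Qs u -> Qs v -> Qs (u - v).
Proof. by move=> hu hv; apply: QsD => //; exact: QsN. Qed.

Lemma QsM u v : Qs u -> Qs v -> Qs (u * v).
Proof.
move=> [p [q ->]] [p' [q' ->]]; exists (p * p' + 5 * (q * q')), (p * q' + q * p').
have h : Num.sqrt 5 ^+ 2 = 5 :> R := alpha_sqr R.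
rewrite !(rmorphD, rmorphM) /= !rmorph1; move: h; set a := Num.sqrt _ => h.
have h' : ratr q * ratr q' * a ^+ 2 = ratr q * ratr q' * 5 by rewrite h.
by lra.
Qed.

Lemma QsV u : Qs u -> Qs u^-1.
Proof.
move=> [p [q eu]]; have [->|u0] := eqVneq u 0; first by rewrite invr0; exact: Qs_nat 0.
have h : Num.sqrt 5 ^+ 2 = 5 :> R := alpha_sqr R.
pose c := ratr p - ratr q * Num.sqrt 5 : R.
have huc : u * c = ratr (p * p - 5 * (q * q)).
  rewrite eu /c !(rmorphB, rmorphD, rmorphM) /= !rmorph1.
  move: h; set a := Num.sqrt _ => h.
  have h' : ratr q ^+ 2 * a ^+ 2 = ratr q ^+ 2 * 5 by rewrite h.
  by lra.
(* If the conjugate vanishes, then p equals q sqrt 5 in R, and u = 2 p is rational. *)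
have [c0|c0] := eqVneq c 0.
  have -> : u = ratr (2 * p).
    by rewrite eu rmorphM /= !(rmorphD, rmorph1); move: c0; rewrite /c => c0; lra.
  by rewrite -fmorphV; exact: Qs_rat.
have -> : u^-1 = c * (ratr (p * p - 5 * (q * q)))^-1.
  by rewrite -huc invfM mulrCA divff// mulr1.
apply: QsM; last by rewrite -fmorphV; exact: Qs_rat.
by apply: QsB; [exact: Qs_rat|apply: QsM; [exact: Qs_rat|exists 0, 1; rewrite rmorph0 rmorph1 mul1r add0r]].
Qed.

Lemma Qs_alpha : Qs alpha.
Proof. by exists 0, 1; rewrite rmorph0 rmorph1 mul1r add0r. Qed.

Lemma Qs_omega : Qs omega.
Proof.
rewrite omega_alpha; apply: QsM; last exact/QsV/(Qs_nat 2).
by apply: QsD; [exact: Qs_alpha|exact: Qs_nat 1].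
Qed.

Lemma Qs_beta : Qs beta. Proof. exact: QsV Qs_omega. Qed.

Lemma QsX u n : Qs u -> Qs (u ^+ n).
Proof. by move=> hu; elim: n => [|n IH]; [exact: Qs_nat 1|rewrite exprS; exact: QsM]. Qed.

Lemma Qs_mul_cancel u v : Qs u -> u != 0 -> Qs (u * v) -> Qs v.
Proof. by move=> hu u0 h; rewrite -(mulKf u0 v); apply: QsM => //; exact: QsV. Qed.

End QuadraticField.

(** * Eventual periodicity under [renorm] and membership in Q(sqrt 5) *)

Section Renormalization.
Variable R : realType.
Local Notation omega := (@omega R).
Local Notation beta := (@beta R).
Local Notation Qs := (@in_Qsqrt5 R).
Local Notation renorm := (@renorm R).
Implicit Types u v : R.

(** On [0, 1] the value 0 is taken only at 0, beta^2, beta and 1. All that is kept of this is that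
    these points lie in Q(sqrt 5), as needed to pull membership back along an orbit. *)
Variant renorm_spec u : R -> Prop :=
| RenormLow of 0 < u < beta ^+ 2 : renorm_spec u (omega ^+ 2 * u)
| RenormMid of beta ^+ 2 < u < beta : renorm_spec u (omega ^+ 3 * (beta - u))
| RenormHigh of beta < u < 1 : renorm_spec u (omega ^+ 2 * (1 - u))
| RenormEnd of (0 <= u <= 1 -> Qs u) : renorm_spec u 0.

Lemma renormP u : renorm_spec u (renorm u).
Proof.
rewrite /renorm; case: ifPn => [h|h1]; first by constructor 1.
case: ifPn => [h|h2]; first by constructor 2.
case: ifPn => [h|h3]; first by constructor 3.
constructor 4 => /andP[u0 u1]; have hb := Qs_beta R.
have [->|un0] := eqVneq u 0; first exact: Qs_nat 0.
have [->|un1] := eqVneq u 1; first exact: Qs_nat 1.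
have [->|ub2] := eqVneq u (beta ^+ 2); first exact: QsX.
have [->//|ub] := eqVneq u beta.
move: h1; rewrite lt_neqAle eq_sym un0 u0 /= -leNgt => h1.
move: h2; rewrite lt_neqAle eq_sym ub2 h1 /= -leNgt => h2.
by move: h3; rewrite lt_neqAle eq_sym ub h2 /= lt_neqAle un1 u1.
Qed.

Lemma omega_beta : omega * beta = 1.
Proof. by rewrite mulfV// lt0r_neq0 ?omega_gt0. Qed.

Lemma renorm_itv u : 0 <= u <= 1 -> 0 <= renorm u <= 1.
Proof.
have hw := omega_sqr R; have w1 := omega_gt1 R; have hb := betaE R; have hb2 := beta_sqr R.
have hw3 : omega ^+ 3 = 2 * omega + 1 by rewrite exprS hw; move: hw; lra.
move=> _; case: renormP => [||| _]; last by rewrite lexx ler01.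
- rewrite hb2 hb => /andP[h1 h2]; rewrite hw; apply/andP; split; nra.
- rewrite hb2 hb => /andP[h1 h2]; rewrite hw3; apply/andP; split; nra.
- rewrite hb => /andP[h1 h2]; rewrite hw; apply/andP; split; nra.
Qed.

Lemma iter_renorm_itv n u : 0 <= u <= 1 -> 0 <= iter n renorm u <= 1.
Proof. by move=> h; elim: n => // n /renorm_itv. Qed.

Lemma Qs_renorm u : 0 <= u <= 1 -> Qs (renorm u) -> Qs u.
Proof.
move=> hu; have hw := Qs_omega R; have w0 : omega != 0 by rewrite lt0r_neq0 ?omega_gt0.
case: renormP => [_|_|_|h _]; last exact: h.
- by apply: Qs_mul_cancel; [exact: QsX|rewrite expf_neq0].
- move=> h; have : Qs (beta - u) by apply: Qs_mul_cancel h; [exact: QsX|rewrite expf_neq0].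
  by move=> /(QsB (Qs_beta R)); rewrite subKr.
- move=> h; have : Qs (1 - u) by apply: Qs_mul_cancel h; [exact: QsX|rewrite expf_neq0].
  by move=> /(QsB (Qs_nat R 1)); rewrite subKr.
Qed.

Lemma iter_Qs_renorm n u : 0 <= u <= 1 -> Qs (iter n renorm u) -> Qs u.
Proof.
move=> hu; elim: n => // n IH h; apply/IH/Qs_renorm => //; exact: iter_renorm_itv.
Qed.

(** The coefficients depend on u: d is the product of the slopes omega^2, - omega^3, - omega^2 of
    the branches visited, or 0 once the orbit meets a break point. In both cases d differs from 1,
    so a periodic point is the solution in Q(sqrt 5) of v = c + d v. *)
Lemma iter_renorm_affine p u : (0 < p)%N ->
  exists c d, [/\ Qs c, Qs d, d = 0 \/ 1 < `|d| & iter p renorm u = c + d * u].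
Proof.
have hw := Qs_omega R; have hb := Qs_beta R; have w1 := omega_gt1 R.
have w2 : 1 < omega ^+ 2 by rewrite exprn_egt1.
have w3 : 1 < omega ^+ 3 by rewrite exprn_egt1.
have step v : exists c d, [/\ Qs c, Qs d, d = 0 \/ 1 < `|d| & renorm v = c + d * v].
  case: renormP => _.
  - exists 0, (omega ^+ 2); rewrite add0r; split=> //; [exact: Qs_nat 0|exact: QsX|right].
    by rewrite gtr0_norm// (lt_trans ltr01).
  - exists (omega ^+ 3 * beta), (- omega ^+ 3); split; last by ring.
    + by apply: QsM => //; exact: QsX.
    + exact/QsN/QsX.
    + by right; rewrite normrN gtr0_norm// (lt_trans ltr01).
  - exists (omega ^+ 2), (- omega ^+ 2); split; last by ring.
    + exact: QsX.
    + exact/QsN/QsX.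
    + by right; rewrite normrN gtr0_norm// (lt_trans ltr01).
  - by exists 0, 0; rewrite mul0r addr0; split=> //; [exact: Qs_nat 0|exact: Qs_nat 0|left].
case: p => // p _; elim: p => [|p [c [d [hc hd hd1 e]]]] /=; first exact: step.
have [c' [d' [hc' hd' hd1' e']]] := step (iter p.+1 renorm u).
exists (c' + d' * c), (d' * d); split.
- by apply: QsD => //; exact: QsM.
- exact: QsM.
- case: hd1 => [->|h1]; first by left; rewrite mulr0.
  case: hd1' => [->|h2]; first by left; rewrite mul0r.
  by right; rewrite normrM mulr_egt1.
- by transitivity (renorm (iter p.+1 renorm u)) => //; rewrite e' e; ring.
Qed.

Lemma Qs_eventually_periodic u : 0 <= u <= 1 -> eventually_periodic renorm u -> Qs u.
Proof.
move=> hu [n [p [p0]]]; rewrite addnC iterD; set v := iter n renorm u => hv.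
apply: (iter_Qs_renorm (n := n)) => //; rewrite -/v.
have [c [d [hc hd hd1 e]]] := iter_renorm_affine v p0.
have d1 : 1 - d != 0.
  rewrite subr_eq0; apply/eqP => e1; case: hd1; rewrite -e1; first by move/eqP; rewrite oner_eq0.
  by rewrite normr1 ltxx.
apply: (Qs_mul_cancel (u := 1 - d)) => //; first by apply: QsB => //; exact: Qs_nat 1.
by rewrite (_ : (1 - d) * v = c)//; move: hv; rewrite e => hv; rewrite mulrBl mul1r -{1}hv addrK.
Qed.

Lemma pigeonhole (A : set R) (f : nat -> R) : finite_set A -> (forall n, A (f n)) ->
  exists i j, (i < j)%N /\ f i = f j.
Proof.
move=> hA hf; apply: contrapT => hn; apply: infinite_nat.
rewrite (_ : [set: nat] = f @^-1` A); last by apply/seteqP; split=> // n _; exact: hf.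
apply: finite_preimage hA => i j _ _ e.
have [h|h|//] := ssrnat.ltngtP i j; first by case: hn; exists i, j; split.
by case: hn; exists j, i; split.
Qed.

Lemma int_ord (K : nat) (k : int) : - K%:Z <= k -> k < K%:Z ->
  exists i : 'I_(K + K), k%:~R = i%:R - K%:R :> R.
Proof.
move=> k1 k2; have hi : (absz (k + K%:Z)%R < K + K)%N by lia.
exists (Ordinal hi) => /=; rewrite -[LHS](addrK K%:R); congr (_ - _).
have e : (absz (k + K%:Z)%R : int) = k + K%:Z by lia.
by rewrite [in RHS]pmulrn e intrD.
Qed.

(* The conjugate 1 - omega of omega has modulus beta < 1, hence renorm preserves
   the finite set of the points of [0, 1] with denominator N and conjugate at most
   M in modulus. *)
Lemma eventually_periodic_Qs u : 0 <= u <= 1 -> Qs u -> eventually_periodic renorm u.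
Proof.
move=> hu [p [q eu]].
have hw := omega_sqr R; have w1 := omega_gt1 R; have w2 := omega_lt2 R.
have hw3 : omega ^+ 3 = 2 * omega + 1 by rewrite exprS hw; move: hw; lra.
have hb := betaE R.
pose N : int := denq p * denq q.
have N0 : 0 < N by rewrite mulr_gt0.
have NR0 : 0 < N%:~R :> R by rewrite ltr0z.
pose good (M : R) (a b : int) v := N%:~R * v = a%:~R + b%:~R * omega /\
  `|a%:~R + b%:~R * (1 - omega)| <= M.
(* M also dominates N, so that it absorbs the constant terms of the two decreasing branches. *)
have [M [hM [a0 [b0 hab0]]]] : exists M : R, N%:~R <= M /\ exists a b, good M a b u.
  (* These come from N u = numq p denq q + numq q denq p sqrt 5 with sqrt 5 = 2 omega - 1. *)
  pose a : int := numq p * denq q - numq q * denq p; pose b : int := 2 * numq q * denq p.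
  exists (N%:~R + `|a%:~R + b%:~R * (1 - omega)|); split; first by rewrite lerDl.
  exists a, b; split; last by rewrite lerDr ltW.
  have hr (r : rat) : (denq r)%:~R * ratr r = (numq r)%:~R :> R.
    by rewrite /ratr mulrC divfK// intr_eq0 denq_neq0.
  have hp := hr p; have hq := hr q; rewrite eu -/alpha alpha_omega.
  rewrite /N /a /b !(intrB, intrM) -hp -hq.
  by ring.
clearbody N.
have hgood n : exists a b, good M a b (iter n renorm u).
  elim: n => [|n [a [b [h1 h2]]]]; first by exists a0, b0.
  rewrite iterS; set v := iter n renorm u in h1 *.
  set c := _ + _ * (1 - omega) in h2; move: h2; rewrite ler_norml => /andP[h2 h3].
  have hbb : (1 - omega) * (1 - omega) = 2 - omega.
    by rewrite (_ : _ * _ = 1 - 2 * omega + omega ^+ 2); [rewrite hw|]; ring.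
  have hM0 : 0 <= M by rewrite (le_trans _ hM)// ltW.
  have ec : c = a%:~R + b%:~R * (1 - omega) by [].
  clearbody c.
  have f1 : 0 <= (omega - 1) * M by rewrite mulr_ge0// subr_ge0 ltW.
  have f2 : 0 <= (2 - omega) * (M - c) by rewrite mulr_ge0 ?subr_ge0// ltW.
  have f3 : 0 <= (2 - omega) * (M + c) by rewrite mulr_ge0 ?subr_ge0 ?(ltW w2)//; lra.
  have ew : b%:~R * omega ^+ 2 = b%:~R * omega + b%:~R by rewrite hw mulrDr mulr1.
  have ea : a%:~R * omega ^+ 2 = a%:~R * omega + a%:~R by rewrite hw mulrDr mulr1.
  have ew3 : b%:~R * omega ^+ 3 = 2 * (b%:~R * omega) + b%:~R by rewrite hw3; ring.
  case: renormP => _.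
  - exists (a + b), (a + 2 * b); rewrite /good !(intrD, intrM) mulrCA h1 hw; split; first by lra.
    rewrite [X in `|X|](_ : _ = (2 - omega) * c); last by rewrite ec; lra.
    by rewrite ler_norml; apply/andP; split; lra.
  - exists (N - (a + 2 * b)), (N - (2 * a + 3 * b)).
    rewrite /good !(intrB, intrD, intrM, intrN) hw3 hb; split.
      have -> : N%:~R * ((2 * omega + 1) * (omega - 1 - v)) =
        (2 * omega + 1) * (N%:~R * (omega - 1)) - (2 * omega + 1) * (N%:~R * v) by ring.
      have eN : N%:~R * omega ^+ 2 = N%:~R * omega + N%:~R :> R by rewrite hw mulrDr mulr1.
      by rewrite h1; lra.
    rewrite [X in `|X|](_ : _ = (2 - omega) * (N%:~R - (1 - omega) * c)); last by rewrite ec; lra.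
    (* N and |c| are at most M and |1 - omega| = omega - 1, whence omega M. The factor 2 - omega
       then gives (2 - omega) omega = omega - 1 < 1. *)
    have h4 : `|N%:~R - (1 - omega) * c| <= omega * M.
      rewrite ler_norml; apply/andP; split; nra.
    rewrite normrM ger0_norm; last by rewrite subr_ge0 ltW.
    apply: (le_trans (ler_wpM2l _ h4)); first by rewrite subr_ge0 ltW.
    rewrite [leLHS](_ : _ = (2 * omega - omega ^+ 2) * M); last by ring.
    by rewrite hw; nra.
  - exists (N - (a + b)), (N - (a + 2 * b)).
    rewrite /good !(intrB, intrD, intrM, intrN) hw; split.
      have -> : N%:~R * ((omega + 1) * (1 - v)) =
        (omega + 1) * N%:~R - (omega + 1) * (N%:~R * v) by ring.
      by rewrite h1; lra.
    rewrite [X in `|X|](_ : _ = (2 - omega) * (N%:~R - c)); last by rewrite ec; lra.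
    have h4 : `|N%:~R - c| <= 2 * M by rewrite ler_norml; apply/andP; split; lra.
    rewrite normrM ger0_norm; last by rewrite subr_ge0 ltW.
    apply: (le_trans (ler_wpM2l _ h4)); first by rewrite subr_ge0 ltW.
    (* Equivalent to 2 (2 - omega) <= 1, the contraction required on this branch. *)
    have w3 : 3 <= 2 * omega by rewrite leNgt; apply/negP => ?; nra.
    by nra.
  - by exists 0, 0; rewrite /good mulr0 !mul0r addr0 normr0.
(* For v in [0, 1], the difference of N v and its conjugate is b (2 omega - 1), whence |b| <= N + M;
   then a = N v - b omega and omega < 2 give |a| <= 3 N + 2 M. *)
pose K := Num.bound (3 * N%:~R + 2 * M).
pose A : set R := (fun ij : 'I_(K + K) * 'I_(K + K) =>
  ((ij.1%:R - K%:R) + (ij.2%:R - K%:R) * omega) / N%:~R) @` [set: 'I_(K + K) * 'I_(K + K)].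
have hA n : A (iter n renorm u).
  have /andP[v0 v1] := iter_renorm_itv n hu; move: v0 v1.
  have [a [b [h1]]] := hgood n; set v := iter n renorm u in h1 *.
  rewrite ler_norml => /andP[h2 h3] v0 v1.
  have hK : 3 * N%:~R + 2 * M < K%:R.
    by apply: archi_boundP; lra.
  have g1 : 0 <= N%:~R * v by rewrite mulr_ge0// ltW.
  have g2 : N%:~R * v <= N%:~R by rewrite ler_piMr// ltW.
  have bK : `|b%:~R| <= N%:~R + M :> R by rewrite ler_norml; apply/andP; split; nra.
  move: bK; rewrite ler_norml => /andP[b1 b2].
  have hint (k : int) : - K%:R <= k%:~R :> R -> k%:~R < K%:R :> R ->
      exists i : 'I_(K + K), k%:~R = i%:R - K%:R :> R.
    by move=> k1 k2; apply: int_ord; rewrite -?(ler_int R) -?(ltr_int R) ?intrN.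
  have c1 : b%:~R * omega <= (N%:~R + M) * omega by rewrite ler_wpM2r// ltW// (lt_trans ltr01).
  have c2 : - (N%:~R + M) * omega <= b%:~R * omega by rewrite ler_wpM2r// ltW// (lt_trans ltr01).
  have c3 : (N%:~R + M) * omega <= (N%:~R + M) * 2 by apply: ler_wpM2l; [lra|exact: ltW].
  have [||i ei] := hint a; [lra|lra|].
  have [||j ej] := hint b; [lra|lra|].
  by exists (i, j) => //=; rewrite -ei -ej -h1 mulrC mulKf// lt0r_neq0.
have [i [j [ij e]]] := pigeonhole (finite_image _ (finite_finset : finite_set [set: 'I_(K + K) * 'I_(K + K)])) hA.
exists i, (j - i)%N; rewrite subn_gt0; split=> //.
by rewrite subnKC// ltnW.
Qed.

End Renormalization.

(** * Widths *)

(* v and v' are points of the closure of P where u_m is maximal and minimal. *)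
Definition extremalb (P : ctile) (m : nat) (v v' : cpoint) : bool :=
  let k := (m %% 5).*2 in
  [&& in_closed P v, in_closed P v',
      infeasible_hp (((k + 5) %% 10, true, aopp (cdot m v)) :: map to_halfplane P)
    & infeasible_hp ((k, true, cdot m v') :: map to_halfplane P)]%N.

Definition widthb (P : ctile) (m : nat) (test : aff -> bool) : bool :=
  has (fun v => has (fun v' => extremalb P m v v' &&
    test (aadd (cdot m v) (aopp (cdot m v')))) (vertices P)) (vertices P).

Section Width.
Variable R : realType.
Implicit Types (A : set (plane R)) (p q : plane R) (w : R) (f : plane R -> plane R).

(** A supremum that is approached but possibly not attained, since tiles are half-open. *)
Definition is_width (m : nat) A w : Prop :=
  (forall p q, A p -> A q -> udot m p - udot m q <= w) /\
  (forall e, 0 < e -> exists p q, [/\ A p, A q & w - e < udot m p - udot m q]).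

Lemma is_width_uniq m A w w' : is_width m A w -> is_width m A w' -> w = w'.
Proof.
suff h w1 w2 : is_width m A w1 -> is_width m A w2 -> w1 <= w2.
  by move=> h1 h2; apply/eqP; rewrite eq_le (h _ _ h1 h2) (h _ _ h2 h1).
move=> [_ h1] [h2 _]; rewrite leNgt; apply/negP => hlt.
have [|p [q [hp hq]]] := h1 (w1 - w2); first by rewrite subr_gt0.
by have := h2 p q hp hq; lra.
Qed.

Definition scales_dot f (eta : R) (m m' : nat) : Prop :=
  exists c, forall p, udot m' (f p) = eta * udot m p + c.

Lemma is_width_image f eta m m' A w : 0 < eta -> scales_dot f eta m m' ->
  is_width m' (f @` A) (eta * w) <-> is_width m A w.
Proof.
move=> eta0 [c hf].
have hd p q : udot m' (f p) - udot m' (f q) = eta * (udot m p - udot m q).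
  by rewrite !hf; ring.
split=> -[h1 h2]; split.
- move=> p q hp hq; rewrite -(ler_pM2l eta0) -hd.
  by apply: h1; [exists p|exists q].
- move=> e e0; have [|_ [_ [[p hp <-] [q hq <-]]]] := h2 (eta * e); first by rewrite mulr_gt0.
  rewrite hd -mulrBr ltr_pM2l// => hlt; by exists p, q.
- by move=> _ _ [p hp <-] [q hq <-]; rewrite hd ler_pM2l//; exact: h1.
- move=> e e0; have [|p [q [hp hq hlt]]] := h2 (e / eta); first by rewrite divr_gt0.
  exists (f p), (f q); split; [by exists p|by exists q|rewrite hd].
  by move: hlt; rewrite -(ltr_pM2l eta0) mulrBr (mulrC eta (e / eta)) divfK ?lt0r_neq0.
Qed.

(** The correspondence of directions is stated both ways so that the induction passes through
    inverses, where m and m' exchange roles. *)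
Lemma frakG_scales f : frakG f -> exists2 eta : R, 0 < eta &
  (forall m, exists m', scales_dot f eta m m') /\ (forall m', exists m, scales_dot f eta m m').
Proof.
elim=> {f}.
- exists 1 => //; split=> m.
    by exists m.+1, 0 => p; rewrite udot_rot1 mul1r addr0.
  exists (m + 4)%N, 0 => p; rewrite mul1r addr0 -(udot_rot1 (m + 4)).
  by rewrite -[RHS]udot_mod -addnS modnDr udot_mod.
- exists 1 => //; split=> m.
    by exists (5 - m %% 5)%N, 0 => p; rewrite udot_refl0 mul1r addr0.
  exists (5 - m %% 5)%N, 0 => p; rewrite mul1r addr0 -[RHS](udot_refl0 (5 - m %% 5)%N).
  rewrite -[LHS]udot_mod -[RHS]udot_mod; have : (m %% 5 < 5)%N by rewrite ltn_mod.
  by move: (m %% 5)%N => [|[|[|[|[|k]]]]].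
- move=> d; exists 1 => //; split=> m; exists m, (udot m d) => p; by rewrite /trans udotD mul1r.
- by move=> eta eta0; exists eta => //; split=> m; exists m, 0 => p; rewrite (udotZ m eta p) addr0.
- by exists 1 => //; split=> m; exists m, 0 => p; rewrite mul1r addr0.
- move=> g h _ [a a0 [ag ag']] _ [b b0 [bh bh']]; exists (a * b); first by rewrite mulr_gt0.
  split=> m.
    have [m1 [c1 h1]] := bh m; have [m2 [c2 h2]] := ag m1.
    by exists m2, (a * c1 + c2) => p /=; rewrite h2 h1; ring.
  have [m1 [c1 h1]] := ag' m; have [m2 [c2 h2]] := bh' m1.
  by exists m2, (a * c2 + c1) => p /=; rewrite h1 h2; ring.
- move=> g h _ [a a0 [ag ag']] gh hg; exists a^-1; first by rewrite invr_gt0.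
  split=> m.
    have [m1 [c1 h1]] := ag' m; exists m1, (- (a^-1 * c1)) => p.
    by have := h1 (h p); rewrite hg => ->; field; rewrite lt0r_neq0.
  have [m1 [c1 h1]] := ag m; exists m1, (- (a^-1 * c1)) => p.
  by have := h1 (h p); rewrite hg => ->; field; rewrite lt0r_neq0.
Qed.

Section TileWidth.
Variables (x y : R).
Hypothesis hxy : parameters x y.

Lemma closure_udot A p m e : closure A p -> 0 < e -> exists2 q, A q & `|udot m q - udot m p| <= e.
Proof.
move=> hA e0; have [|q [hq [/= h1 h2]]] := hA (ball p (e / 2)).
  by apply/nbhs_ballP; exists (e / 2) => //=; rewrite divr_gt0.
exists q => //; have hu (a b : plane R) : udot m a - udot m b = udot m (a.1 - b.1, a.2 - b.2).
  have -> : udot m a = udot m (a.1 - b.1, a.2 - b.2) + udot m b.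
    by rewrite -udotD !subrK; case: a.
  by rewrite addrK.
have h12 (a b : plane R) : `|a.1 - b.1| <= e / 2 -> `|a.2 - b.2| <= e / 2 -> udot m a - udot m b <= e.
  by move=> k1 k2; rewrite hu; have := @udot_le R m (_, _) _ k1 k2; lra.
rewrite ler_norml; apply/andP; split.
  by rewrite lerNl opprB h12// ltW.
by rewrite h12// distrC ltW.
Qed.

Lemma extremalP P m v v' : has_interior P -> extremalb P m v v' ->
  is_width m (tl x y P) (ev x y (aadd (cdot m v) (aopp (cdot m v')))).
Proof.
move=> /(has_interiorP hxy)[z hz] /and4P[hv hv' hmax hmin].
rewrite ev_add ev_opp !ev_cdot; split=> [p q hp hq|e e0].
  have h1 : udot m p <= udot m (evp x y v).
    rewrite leNgt; apply/negP => hlt; apply: (infeasible_hpP hxy (p := p) hmax) => h.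
    rewrite inE => /orP[/eqP ->|/mapP[c hc ->]]; last by apply/hsat_to_halfplane; move/tlP: hp; apply.
    by rewrite /hsat /= unormal_odd ev_opp ev_cdot ltrN2.
  have h2 : udot m (evp x y v') <= udot m q.
    rewrite leNgt; apply/negP => hlt; apply: (infeasible_hpP hxy (p := q) hmin) => h.
    rewrite inE => /orP[/eqP ->|/mapP[c hc ->]]; last by apply/hsat_to_halfplane; move/tlP: hq; apply.
    by rewrite /hsat /= unormal_even ev_cdot.
  by lra.
have e4 : 0 < e / 4 by rewrite divr_gt0.
have [p hp] := closure_udot m (closure_tl hz (in_closedP hxy hv)) e4.
have [q hq] := closure_udot m (closure_tl hz (in_closedP hxy hv')) e4.
rewrite !ler_norml => /andP[h1 h2] /andP[h3 h4].
by exists p, q; split=> //; lra.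
Qed.

Lemma widthP P m test : has_interior P -> widthb P m test ->
  exists2 w, test w & is_width m (tl x y P) (ev x y w).
Proof.
move=> hP /hasP[v _ /hasP[v' _ /andP[h1 h2]]].
by exists (aadd (cdot m v) (aopp (cdot m v'))) => //; exact: extremalP.
Qed.

Lemma Qs_ev (g : aff) : in_Qsqrt5 x -> in_Qsqrt5 y -> in_Qsqrt5 (ev x y g).
Proof.
move=> hx hy; have hw z : in_Qsqrt5 (wR R z).
  by apply: QsD; [exact: Qs_int|apply: QsM; [exact: Qs_int|exact: Qs_omega]].
apply: QsM; last by apply/QsV/QsM; [exact: Qs_alpha|apply: QsX; exact: Qs_omega].
by apply: QsD; [apply: QsD => //; exact: QsM|exact: QsM].
Qed.

End TileWidth.
End Width.

(** * The rhombus map and its induced maps *)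

Definition ac (a b : Z) : aff := acst (a, b).
Definition ms (a b : Z) : aff := aadd (ac a b) (aopp a_s).
Definition mt (a b : Z) : aff := aadd (ac a b) (aopp a_t).

Definition ltc (m : nat) (b : aff) : constr := (m, true, b).
Definition gec (m : nat) (b : aff) : constr := (m, false, b).

Definition rhombus_system : system :=
  System [:: gec 0 (mt 0 0); gec 1 (ms 0 0); ltc 0 (mt 1 0); ltc 1 (ms 1 0)]
    [:: ([:: gec 0 (mt 0 0); gec 1 (mt 0 0); gec 2 (ms 0 0); ltc 1 (ms 1 0)],
         ((ac 0 0, ac 0 0), 4));
        ([:: ltc 0 (mt 1 0); ltc 1 (ms 1 0); ltc 2 (ms 0 0); gec 1 (mt 0 0)],
         ((ac 0 0, ac 1 0), 4));
        ([:: gec 0 (mt 0 0); gec 1 (ms 0 0); gec 2 (ms (-2) 1); ltc 1 (mt 0 0)],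
         ((ac 1 0, ac 2 (-1)), 4));
        ([:: ltc 0 (mt 1 0); ltc 1 (mt 0 0); ltc 2 (ms (-2) 1); gec 1 (ms 0 0)],
         ((ac 1 0, ac 3 (-1)), 4))]%N.

Definition lin (tau : aff) (a b c d : Z) : aff := aadd (ac a b) (ascale (c, d) tau).

(** The offsets are those of [base_triangle], reduced by omega^2 = omega + 1 and omega^3 = 2 omega +
    1. *)
Definition base_system (tau : aff) : system :=
  System [:: gec 1 (lin tau (-1) (-1) 1 0); ltc 0 (ac 0 0); ltc 2 (ac 0 0)]
    [:: ([:: ltc 0 (ac 0 0); ltc 2 (ac 0 0); ltc 3 (lin tau 0 1 0 (-1))],
         ((lin tau 0 (-1) 0 1, lin tau (-1) (-1) 1 1), 2));
        ([:: gec 1 (lin tau (-1) (-1) 1 0); ltc 4 (lin tau 1 1 0 (-1)); ltc 0 (ac 0 0);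
             gec 3 (lin tau 0 1 0 (-1)); ltc 2 (ac 0 0)],
         ((ac 0 0, lin tau (-1) (-2) 1 1), 3));
        ([:: gec 1 (lin tau (-1) (-1) 1 0); ltc 0 (ac 0 0); gec 4 (lin tau 1 1 0 (-1))],
         ((lin tau 0 (-2) 0 1, lin tau (-2) (-2) 1 1), 2))]%N.

(* Pieces are numbered from 0, so that the atom R_k is the piece k - 1. The words in
   return_Y1, return_Y2, return_Y3 and periodic_tiles are itineraries through the
   pieces of the first-return map to R_1, in the order of return_R1. *)
Definition return_R1 : seq (seq nat * ctile) :=
  [:: ([:: 0],
       [:: gec 0 (mt 0 0); gec 1 (mt 0 0); ltc 1 (ms 1 0); gec 2 (mt 0 0); gec 3 (ms 0 0)]);
      ([:: 0; 1],
       [:: ltc 1 (ms 1 0); gec 2 (mt 0 0); ltc 3 (ms 0 0)]);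
      ([:: 0; 3],
       [:: ltc 1 (ms 1 0); gec 2 (ms 0 0); ltc 3 (ms (-2) 1)]);
      ([:: 0; 2; 1],
       [:: gec 1 (mt 0 0); gec 2 (ms 0 0); ltc 2 (mt 0 0); gec 3 (mt (-2) 1)]);
      ([:: 0; 2; 3],
       [:: gec 0 (ms 1 0); ltc 1 (ms 1 0); gec 2 (ms 0 0); gec 3 (ms (-2) 1); ltc 4 (ms 2 (-1))]);
      ([:: 0; 2; 2; 3],
       [:: gec 1 (ms 4 (-2)); gec 2 (ms 0 0); gec 4 (ms 2 (-1))]);
      ([:: 0; 2; 3; 1],
       [:: ltc 0 (ms 1 0); ltc 1 (ms 1 0); ltc 2 (mt 0 0); ltc 3 (mt (-2) 1); ltc 4 (ms 2 (-1))]);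
      ([:: 0; 2; 2; 3; 1],
       [:: ltc 1 (ms 4 (-2)); gec 2 (ms 0 0); ltc 3 (mt (-2) 1); gec 4 (ms 2 (-1))])]%N.

Definition Y1 : ctile :=
  [:: gec 2 (ms 0 0); ltc 1 (ms 1 0); ltc 3 (ms (-2) 1)]%N.

Definition return_Y1 : seq (seq nat * ctile) :=
  [:: ([:: 2],
       [:: ltc 0 (ms (-7) 5); ltc 1 (ms 1 0); ltc 3 (ms (-2) 1)]);
      ([:: 2; 4; 4],
       [:: gec 0 (ms (-7) 5); ltc 1 (ms 1 0); gec 2 (ms 0 0); ltc 3 (ms (-2) 1); ltc 4 (ms 10 (-6))]);
      ([:: 2; 4; 5; 4],
       [:: gec 2 (ms 0 0); ltc 3 (ms (-2) 1); gec 4 (ms 10 (-6))])]%N.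

Definition Y2 : ctile :=
  [:: gec 0 (mt 0 0); ltc 1 (mt (-3) 2); ltc 4 (mt 0 0)]%N.

Definition return_Y2 : seq (seq nat * ctile) :=
  [:: ([:: 3],
       [:: ltc 1 (mt (-3) 2); ltc 2 (mt 0 0); ltc 4 (mt 0 0)]);
      ([:: 0; 3; 3],
       [:: gec 0 (mt 0 0); ltc 1 (mt (-3) 2); gec 2 (mt 0 0); ltc 3 (mt 0 0); ltc 4 (mt 0 0)]);
      ([:: 0; 0; 3; 3],
       [:: gec 0 (mt 0 0); gec 3 (mt 0 0); ltc 4 (mt 0 0)])]%N.

Definition Y3 : ctile :=
  [:: gec 2 (ms 2 (-1)); ltc 1 (ms 1 0); ltc 3 (ms 0 0)]%N.

Definition return_Y3 : seq (seq nat * ctile) :=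
  [:: ([:: 1],
       [:: ltc 0 (ms (-1) 1); ltc 1 (ms 1 0); ltc 3 (ms 0 0)]);
      ([:: 1; 0; 7],
       [:: gec 0 (ms (-1) 1); ltc 1 (mt (-1) 1); gec 2 (ms 2 (-1)); ltc 3 (ms 0 0); ltc 4 (ms 5 (-3))]);
      ([:: 1; 0; 5; 7],
       [:: gec 2 (ms 2 (-1)); ltc 3 (ms 0 0); gec 4 (ms 5 (-3))]);
      ([:: 1; 0; 3; 0; 3; 0; 3; 0; 3],
       [:: gec 0 (ms (-1) 1); gec 1 (mt (-1) 1); ltc 1 (ms 1 0); gec 2 (ms 2 (-1))])]%N.

Definition periodic_tiles : seq (seq nat * ctile) :=
  [:: ([:: 6],
       [:: ltc 0 (mt (-1) 1); ltc 1 (mt (-1) 1); ltc 2 (mt 0 0); ltc 3 (mt (-2) 1); ltc 4 (mt 0 0)]);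
      ([:: 0; 3],
       [:: gec 0 (ms 2 (-1)); gec 1 (ms (-1) 1); gec 2 (ms 2 (-1)); gec 3 (ms 0 0); gec 4 (ms 0 0)]);
      ([:: 0; 6; 6; 6; 1],
       [:: gec 0 (mt 0 0); ltc 0 (ms 2 (-1)); ltc 1 (mt (-1) 1); ltc 4 (mt (-2) 1)]);
      ([:: 0; 3; 0; 3; 0; 3; 1; 0; 6; 6; 1],
       [:: gec 0 (mt 0 0); ltc 0 (ms 2 (-1)); gec 4 (mt (-2) 1); ltc 4 (ms 0 0)]);
      ([:: 4],
       [:: gec 0 (ms 1 0); gec 1 (ms (-4) 3); gec 2 (ms 0 0); gec 3 (ms (-2) 1); gec 4 (ms (-3) 2)]);
      ([:: 5],
       [:: gec 0 (ms 1 0); gec 1 (ms 4 (-2)); gec 2 (ms 0 0); gec 3 (ms 3 (-2)); gec 4 (ms 2 (-1))]);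
      ([:: 0],
       [:: gec 0 (mt 0 0); gec 1 (mt 0 0); gec 2 (mt 0 0); gec 3 (mt 0 0); gec 4 (mt 0 0)])]%N.

Definition R1 : ctile := (piece rhombus_system 0).1.
Definition F_system : system := induced rhombus_system R1 return_R1.

Definition singletons (data : seq (seq nat * ctile)) : seq group :=
  [seq ([:: i], (nth ([::], [::]) data i).2) | i <- iota 0 (size data)].

(* The pieces with itineraries 1 0 7 and 1 0 3 0 3 0 3 0 3 carry the same isometry. *)
Definition groups_Y3 : seq group :=
  let P i := (nth ([::], [::]) return_Y3 i).2 in
  [:: ([:: 0], P 0);
      ([:: 1; 3],
       [:: gec 0 (ms (-1) 1); ltc 1 (ms 1 0); gec 2 (ms 2 (-1)); ltc 3 (ms 0 0); ltc 4 (ms 5 (-3))]);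
      ([:: 2], P 2)]%N.

(** The apex of the base triangle, where u_0 and u_2 vanish, is the origin. With - p and - q the
    offsets of the two sides sent to these lines, the shift solves the equations that bring both
    offsets to 0; the factor omega is the inverse of the coefficient beta in u_2. *)
Definition apex_shift (n : nat) (p q : aff) : cpoint :=
  let d := ascale (wpow wom n) p in
  (d, ascale wom (aadd (ascale (wpow wom n) q) d)).

(** In the three gauges, the homothety ratio is the power of omega occurring in the shape parameter
    of the triangle. *)
Definition gauge1 : gauge :=
  Gauge (wpow wom 6) true 3 (apex_shift 6 (aopp (ms (-2) 1)) (aopp (ms 1 0))).
Definition gauge2 : gauge :=
  Gauge (wpow wom 4) false 1 (apex_shift 4 (aopp (mt 0 0)) (aopp (mt (-3) 2))).
Definition gauge3 : gauge :=
  Gauge (wpow wom 4) true 3 (apex_shift 4 (aopp (ms 0 0)) (aopp (ms 1 0))).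

(** * Certificates decided by computation *)

Lemma check_rhombus : partitionb rhombus_system.
Proof. by vm_compute. Qed.

Lemma check_base tau : tau \in [:: ax; ay; ascale wbe2 ax] -> partitionb (base_system tau).
Proof. by move: tau; apply/allP; vm_compute. Qed.

Lemma check_return_R1 : first_return_data rhombus_system R1 return_R1.
Proof. by vm_compute. Qed.

Lemma check_tiling_R1 : tilingb rhombus_system [:: (R1, return_R1)] [::].
Proof. by vm_compute. Qed.

Lemma check_dressed_F : dressedb F_system.
Proof. by vm_compute. Qed.

Lemma check_tiling_F :
  tilingb F_system [:: (Y1, return_Y1); (Y2, return_Y2); (Y3, return_Y3)] periodic_tiles.
Proof. by vm_compute. Qed.

Lemma check_return_Y1 : first_return_data F_system Y1 return_Y1.
Proof. by vm_compute. Qed.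

Lemma check_dressed_Y1 : dressedb (induced F_system Y1 return_Y1).
Proof. by vm_compute. Qed.

Lemma check_triangle_Y1 : polygonb Y1.
Proof. by vm_compute. Qed.

Lemma check_subset_Y1 : included Y1 R1.
Proof. by vm_compute. Qed.

Lemma check_return_Y2 : first_return_data F_system Y2 return_Y2.
Proof. by vm_compute. Qed.

Lemma check_dressed_Y2 : dressedb (induced F_system Y2 return_Y2).
Proof. by vm_compute. Qed.

Lemma check_triangle_Y2 : polygonb Y2.
Proof. by vm_compute. Qed.

Lemma check_subset_Y2 : included Y2 R1.
Proof. by vm_compute. Qed.

Lemma check_return_Y3 : first_return_data F_system Y3 return_Y3.
Proof. by vm_compute. Qed.

Lemma check_dressed_Y3 : dressedb (induced F_system Y3 return_Y3).
Proof. by vm_compute. Qed.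

Lemma check_triangle_Y3 : polygonb Y3.
Proof. by vm_compute. Qed.

Lemma check_subset_Y3 : included Y3 R1.
Proof. by vm_compute. Qed.

Lemma check_similar1 :
  mergeb (induced F_system Y1 return_Y1) (singletons return_Y1) &&
  similarb (induced F_system Y1 return_Y1) (singletons return_Y1) (base_system ax) gauge1.
Proof. by vm_compute. Qed.

Lemma check_similar2 :
  mergeb (induced F_system Y2 return_Y2) (singletons return_Y2) &&
  similarb (induced F_system Y2 return_Y2) (singletons return_Y2) (base_system ay) gauge2.
Proof. by vm_compute. Qed.

Lemma check_similar3 :
  mergeb (induced F_system Y3 return_Y3) groups_Y3 &&
  similarb (induced F_system Y3 return_Y3) groups_Y3 (base_system (ascale wbe2 ax)) gauge3.
Proof. by vm_compute. Qed.

Lemma check_widths :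
  all (fun P => has_interior P && all (fun m => widthb P m xpredT) (iota 0 5))
    (sdom (base_system ax) :: [seq PT.1 | PT <- spieces (base_system ax)]).
Proof. by vm_compute. Qed.

(** The widths omega^2 - tau here and 1 - tau in [check_width_piece] have a quotient that is
    invariant under similarity and determines tau. *)
Lemma check_width_dom : widthb (sdom (base_system ax)) 1 (pred1 (lin ax 1 1 (-1) 0)).
Proof. by vm_compute. Qed.

Lemma check_width_piece : widthb (piece (base_system ax) 0).1 0 (pred1 (lin ax 1 0 (-1) 0)).
Proof. by vm_compute. Qed.

(** * The base triangle as a symbolic system *)

Section Base.
Variables (R : realType) (x y : R).
Hypothesis hxy : parameters x y.
Local Notation ev := (ev x y).
Local Notation omega := (@omega R).

Lemma ev_ac a b : ev (ac a b) = zR R a + zR R b * omega.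
Proof. by rewrite ev_cst. Qed.

Lemma ev_lin tau a b c d :
  ev (lin tau a b c d) = zR R a + zR R b * omega + (zR R c + zR R d * omega) * ev tau.
Proof. by rewrite ev_add ev_scale ev_ac. Qed.

Lemma zRE : (zR R Z0 = 0) * (zR R (Zpos 1) = 1) * (zR R (Zpos 2) = 2) * (zR R (Zpos 3) = 3) *
  (zR R (Zneg 1) = -1) * (zR R (Zneg 2) = -2).
Proof. by do !split; rewrite /zR //= ?rmorphN. Qed.

Lemma omega_cube : omega ^+ 3 = 2 * omega + 1.
Proof. by rewrite exprS omega_sqr; have := omega_sqr R; lra. Qed.

Lemma models_base tau : tau \in [:: ax; ay; ascale wbe2 ax] ->
  @models R x y (base_triangle (ev tau)) (base_system tau) (fun k => inord k).
Proof.
move=> htau; have h2 := omega_sqr R; have h3 := omega_cube.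
have hz := zRE; apply: (models_of_pieces hxy _ _ _ _ (check_base htau)) => //.
- rewrite /base_dom /tl /=; congr (tile _ _ [:: _; _; _]);
    rewrite ?(ev_lin, ev_ac) ?hz ?h2; ring.
- move=> [[|[|[|k]]] hk] //=; rewrite /tl /=.
  + by congr (tile _ _ [:: _; _; _]); rewrite ?(ev_lin, ev_ac) ?hz ?h2; ring.
  + by congr (tile _ _ [:: _; _; _; _; _]); rewrite ?(ev_lin, ev_ac) ?hz ?h2; ring.
  + by congr (tile _ _ [:: _; _; _]); rewrite ?(ev_lin, ev_ac) ?hz ?h2; ring.
- move=> [[|[|[|k]]] hk] //=; rewrite /evT /evp /=; congr (TR (_, _) _);
    rewrite ?(ev_lin, ev_ac) ?hz ?h2 ?h3; ring.
Qed.

End Base.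

(** * Independence of the chosen shape parameter *)

Section Invariance.
Variable R : realType.
Implicit Types (tau : R) (D : dressed R).

(** Makes the certificates for [ax] available for an arbitrary shape parameter: (1 + tau) / 2 is one
    value of y admissible with x = tau. *)
Lemma parameters_of tau : 0 < tau < 1 -> parameters tau ((1 + tau) / 2).
Proof.
move=> /andP[t0 t1]; split; first by rewrite t0 t1.
have b0 := beta_gt0 R; have b1 := beta_lt1 R; have hb := beta_sqr R.
rewrite ltr_pdivrMr// ltr_pdivlMr// hb; apply/andP; split; last by lra.
by nra.
Qed.

Lemma base_models tau : 0 < tau < 1 ->
  @models R tau ((1 + tau) / 2) (base_triangle tau) (base_system ax) (fun k => inord k).
Proof.
move=> /parameters_of h; have := @models_base R tau ((1 + tau) / 2) h ax.
by rewrite ev_x; apply; rewrite mem_head.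
Qed.

Definition region tau (A : set (plane R)) : Prop :=
  A = dom (base_triangle tau) \/ atoms (base_triangle tau) A.

Lemma region_width tau A m : 0 < tau < 1 -> in_Qsqrt5 tau -> region tau A ->
  exists2 w, in_Qsqrt5 w & is_width m A w.
Proof.
move=> ht hq hA; have hp := parameters_of ht; have hm := base_models ht.
have hy : in_Qsqrt5 ((1 + tau) / 2).
  by apply: QsM; [apply: QsD => //; exact: Qs_nat 1|exact/QsV/(Qs_nat _ 2)].
have [P hP ->] : exists2 P, P \in sdom (base_system ax) :: [seq PT.1 | PT <- spieces (base_system ax)]
    & A = tl tau ((1 + tau) / 2) P.
  case: hA => [->|/(models_atoms hm)[k hk ->]].
    by exists (sdom (base_system ax)); rewrite ?mem_head// (models_dom hm).
  exists (piece (base_system ax) k).1 => //.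
  by rewrite inE; apply/orP; right; apply/map_f/mem_nth.
have /andP[hi /allP hw] := allP check_widths P hP.
have [|w _ h] := widthP hp hi (hw (m %% 5)%N _); first by rewrite mem_iota ltn_mod.
exists (ev tau ((1 + tau) / 2) w); first exact: Qs_ev.
move: h => [h1 h2]; split=> [p q hA1 hA2|e e0]; first by rewrite -(udot_mod m p) -(udot_mod m q); exact: h1.
by have [p [q [k1 k2 k3]]] := h2 e e0; exists p, q; rewrite -(udot_mod m p) -(udot_mod m q).
Qed.

(* A similarity multiplies all widths by one factor; compare the widths of the
   domain and of the first atom. *)
Lemma Qs_similar D tau tau' : 0 < tau < 1 -> 0 < tau' < 1 ->
  similar_dressed D (base_triangle tau) -> similar_dressed D (base_triangle tau') ->
  in_Qsqrt5 tau -> in_Qsqrt5 tau'.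
Proof.
move=> ht ht' [g [hg gdom gat _]] [g' [hg' gdom' gat' _]] hq.
have hm := base_models ht'; have hp := parameters_of ht'.
have [eta eta0 [gs _]] := frakG_scales hg; have [eta' eta0' [_ gs']] := frakG_scales hg'.
(* Pulling back by g' divides the width by eta', and pushing forward by g multiplies it by eta; the
   result is a width in the base triangle of [tau], hence in Q(sqrt 5). *)
have key m w A : is_width m (g' @` A) w -> region tau (g @` A) -> in_Qsqrt5 (eta / eta' * w).
  move=> hw hA; have [m1 hm1] := gs' m; have [m2 hm2] := gs m1.
  have : is_width m1 A (w / eta').
    apply/(is_width_image _ _ eta0' hm1).
    by rewrite mulrC divfK// lt0r_neq0.
  move=> /(is_width_image _ _ eta0 hm2).2 h2.
  have [w2 hq2 h3] := region_width m2 ht hq hA.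
  by rewrite -mulrA (mulrC eta'^-1) (is_width_uniq h2 h3).
have h2 := omega_sqr R; have w1 := omega_gt1 R; have hz := @zRE R.
have /andP[t0' t1'] := ht'.
have all_P := allP check_widths.
have hdom : in_Qsqrt5 (eta / eta' * (omega ^+ 2 - tau')).
  have /andP[hi _] := all_P _ (mem_head _ _).
  have [w /eqP -> hw] := widthP hp hi check_width_dom.
  apply: (key 1%N _ (dom D)); last by left.
  rewrite gdom' (models_dom hm) h2; have <- : ev tau' ((1 + tau') / 2) (lin ax 1 1 (-1) 0) = omega + 1 - tau'.
    by rewrite ev_lin ev_x !hz; ring.
  exact: hw.
have hat : in_Qsqrt5 (eta / eta' * (1 - tau')).
  have /andP[hi _] : has_interior (piece (base_system ax) 0).1 && all (fun m => widthb (piece (base_system ax) 0).1 m xpredT) (iota 0 5).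
    by apply: all_P; rewrite !inE eqxx orbT.
  have [w /eqP -> hw] := widthP hp hi check_width_piece.
  have : atoms (base_triangle tau') (tl tau' ((1 + tau') / 2) (piece (base_system ax) 0).1).
    by apply/(models_atoms hm); exists 0%N.
  rewrite -gat' => -[A hA eA]; apply: (key 0%N _ A).
    rewrite eA; have <- : ev tau' ((1 + tau') / 2) (lin ax 1 0 (-1) 0) = 1 - tau'.
      by rewrite ev_lin ev_x !hz; ring.
    exact: hw.
  by right; rewrite -gat; exists A.
have k0 : eta / eta' != 0 by rewrite mulf_neq0 ?invr_neq0 ?lt0r_neq0.
have d0 : omega ^+ 2 - tau' != 0 by rewrite lt0r_neq0// h2; lra.
(* The unknown factor eta / eta' cancels in q. As omega^2 differs from 1, so does q, and tau' = (1 -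
   q omega^2) / (1 - q). *)
pose q := (1 - tau') / (omega ^+ 2 - tau').
have Qq : in_Qsqrt5 q.
  rewrite (_ : q = (eta / eta' * (1 - tau')) / (eta / eta' * (omega ^+ 2 - tau'))).
    by apply: QsM => //; exact: QsV.
  by rewrite /q invfM mulrACA divff// mul1r.
have hq1 : q * (omega ^+ 2 - tau') = 1 - tau' by rewrite divfK.
have q1 : 1 - q != 0.
  rewrite subr_eq0; apply/eqP => e; move: hq1; rewrite -e mul1r h2 => /eqP.
  by apply/negP; rewrite gt_eqF//; lra.
apply: (Qs_mul_cancel (u := 1 - q)) => //; first by apply: QsB => //; exact: Qs_nat 1.
rewrite (_ : (1 - q) * tau' = 1 - q * omega ^+ 2).
  by apply: QsB; [exact: Qs_nat 1|apply: QsM => //; apply: QsX; exact: Qs_omega].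
by move: hq1; rewrite mulrBr => hq1; lra.
Qed.

Lemma self_similarP D tau : 0 < tau < 1 ->
  similar_dressed (merge_atoms D) (base_triangle tau) -> self_similar D <-> in_Qsqrt5 tau.
Proof.
move=> ht hs; have ltW2 (u : R) : 0 < u < 1 -> 0 <= u <= 1 by move=> /andP[/ltW -> /ltW ->].
split=> [[tau' [ht' hs' hp]]|hq].
  by apply: Qs_similar hs' hs _ => //; apply: Qs_eventually_periodic hp; exact: ltW2.
by exists tau; split=> //; apply: eventually_periodic_Qs hq; exact: ltW2.
Qed.

End Invariance.

(** * The rhombus map in the normalized parameters *)

Section Rhombus.
Variables (R : realType) (s t : R).
Local Notation omega := (@omega R).
Local Notation alpha := (@alpha R).
Local Notation beta := (@beta R).
Let x := omega ^+ 6 * alpha * (s - beta ^+ 2).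
Let y := omega ^+ 4 * alpha * t.

(** The change of parameters is affine and takes the vertices, in order, to (0, 0), (1, beta^2), (1,
    1), (0, 1); in barycentric coordinates x = c2 + c3 and y = beta^2 c2 + c3 + c4. *)
Lemma Pi_star_parameters : Pi_star (s, t) -> parameters x y.
Proof.
have a0 := alpha_gt0 R; have w0 := omega_gt0 R; have b0 := beta_gt0 R; have b1 := beta_lt1 R.
have hab : alpha != 0 by rewrite lt0r_neq0.
have wb n : omega ^+ n * beta ^+ n = 1 by rewrite -exprMn mulfV ?expr1n// lt0r_neq0.
have b2 : beta ^+ 2 < 1 by rewrite expr_lt1// ltW.
have b20 : 0 < beta ^+ 2 by rewrite exprn_gt0.
move=> [c1 [c2 [c3 [c4 [[h1 h2 h3 h4] h5 [es et]]]]]].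
have ex : x = c2 + c3.
  have e6 : omega ^+ 6 * alpha * (beta ^+ 6 / alpha) = 1 by rewrite mulrACA wb divff// mul1r.
  rewrite -[RHS]mulr1 -e6 /x es /GRing.scale /=.
  have -> : c1 = 1 - c2 - c3 - c4 by lra.
  by move: (beta ^+ 6 / alpha) (beta ^+ 2) (omega ^+ 6 * alpha) => B C E; ring.
have ey : y = beta ^+ 2 * c2 + c3 + c4.
  have e4 : omega ^+ 4 * alpha * (beta ^+ 4 / alpha) = 1 by rewrite mulrACA wb divff// mul1r.
  have e6 : omega ^+ 4 * alpha * (beta ^+ 6 / alpha) = beta ^+ 2.
    by rewrite (exprD beta 4 2) -[LHS]mulrA mulrACA; rewrite -[RHS]mul1r -(wb 4%N); field.
  rewrite /y et -e6 -[in RHS](mulr1 c3) -[in RHS](mulr1 c4) -e4 /GRing.scale /=.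
  by move: (beta ^+ 6 / alpha) (beta ^+ 4 / alpha) (omega ^+ 4 * alpha) => B C E; ring.
by rewrite /parameters ex ey; split; apply/andP; split; nra.
Qed.

Lemma ev_as : ev x y a_s = s.
Proof.
have u0 := unit_gt0 R.
rewrite /ev /= wR_mul wR_unit wRbe2 wR1 wR0 mul0r addr0 mul1r mulrDl.
rewrite mulrAC divff ?lt0r_neq0// mul1r /x (mulrC alpha) mulrAC divff ?mul1r; first by rewrite addrC subrK.
by rewrite mulrC lt0r_neq0.
Qed.

Lemma ev_at : ev x y a_t = t.
Proof.
have a0 := lt0r_neq0 (alpha_gt0 R); have w0' := lt0r_neq0 (omega_gt0 R).
rewrite /ev (_ : a_t = (w0, w0, wpow wom 2))// wR0 wR_pow wRom mul0r !add0r /y.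
by field; rewrite a0 w0'.
Qed.

Lemma ev_ms a b : ev x y (ms a b) = zR R a + zR R b * omega - s.
Proof. by rewrite ev_add ev_opp ev_as ev_ac. Qed.

Lemma ev_mt a b : ev x y (mt a b) = zR R a + zR R b * omega - t.
Proof. by rewrite ev_add ev_opp ev_at ev_ac. Qed.

Lemma rhombus_atomE (k : nat) : (k < 4)%N ->
  nth set0 (rhombus_atom s t) k = tl x y (piece rhombus_system k).1.
Proof.
have hz := @zRE R; have hb := betaE R.
move: k => [|[|[|[|k]]]] //= _; rewrite /tl /=; congr (tile _ _ [:: _; _; _; _]);
  rewrite ?(ev_ms, ev_mt) ?hz ?hb; ring.
Qed.

Lemma models_rhombus : parameters x y ->
  @models R x y (rhombus s t) rhombus_system (fun k => inord k).
Proof.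
move=> hxy; have hz := @zRE R; have hb := betaE R; apply: (models_of_pieces hxy _ _ _ _ check_rhombus) => //.
- rewrite /rhombus_dom /tl /=; congr (tile _ _ [:: _; _; _; _]);
    rewrite ?(ev_ms, ev_mt) ?hz; ring.
- by move=> k; apply: rhombus_atomE.
- move=> [[|[|[|[|k]]]] hk] //=; rewrite /evT /evp /=; congr (TR (_, _) _);
    rewrite ?ev_ac ?hz ?hb; ring.
Qed.

End Rhombus.

Theorem mainTheorem2 (R : realType) (s t : R) (hst : Pi_star (s, t)) :
  let F := F_domain s t in
  dressed_domain F /\
  tiled_by_orbits (rhombus s t) [:: nth set0 (rhombus_atom s t) 0] [::] /\
  exists Y1 Y2 Y3 : set (plane R),
    let F1 := subdomain F Y1 in
    let F2 := subdomain F Y2 in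
    let F3 := subdomain F Y3 in
    [/\ [/\ triangle Y1, triangle Y2 & triangle Y3],
        [/\ Y1 `<=` dom F, Y2 `<=` dom F & Y3 `<=` dom F],
        [/\ dressed_domain F1, dressed_domain F2 & dressed_domain F3],
        (exists Ps : seq (set (plane R)),
          [/\ size Ps = 7%N,
              forall j, (j < size Ps)%N -> exists n, periodic_tile F (nth set0 Ps j) n
            & tiled_by_orbits F [:: Y1; Y2; Y3] Ps])
      & [/\ similar_dressed (merge_atoms F1) (base_triangle (omega ^+ 6 * alpha * (s - beta ^+ 2))),
            similar_dressed (merge_atoms F2) (base_triangle (omega ^+ 4 * alpha * t))
          & similar_dressed (merge_atoms F3) (base_triangle (omega ^+ 4 * alpha * (s - beta ^+ 2)))]
        /\
        [/\ self_similar F1 <-> in_Qsqrt5 s,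
            self_similar F3 <-> in_Qsqrt5 s,
            self_similar F2 <-> in_Qsqrt5 t
          & [/\ self_similar F1, self_similar F2 & self_similar F3] <->
            Pi_star (s, t) /\ in_Qsqrt5 s /\ in_Qsqrt5 t]].
Proof.
set x := omega ^+ 6 * alpha * (s - beta ^+ 2); set y := omega ^+ 4 * alpha * t.
have hxy : parameters x y := Pi_star_parameters hst.
have hR := models_rhombus hxy.
have eR1 : nth set0 (rhombus_atom s t) 0 = tl x y R1 by exact: rhombus_atomE.
rewrite /F_domain eR1; set F := subdomain _ _; move=> /=.
have hF := models_induced hxy hR check_return_R1; rewrite -/F -/F_system in hF.
have h1 := models_induced hxy hF check_return_Y1.
have h2 := models_induced hxy hF check_return_Y2.
have h3 := models_induced hxy hF check_return_Y3.
have ex3 : ev x y (ascale wbe2 ax) = omega ^+ 4 * alpha * (s - beta ^+ 2).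
  rewrite ev_scale ev_x wRbe2 /x; have wb : omega ^+ 2 * beta ^+ 2 = 1 :> R.
    by rewrite -exprMn omega_beta expr1n.
  by rewrite -[RHS]mul1r -wb (exprD omega 2 4); ring.
have sim1 : similar_dressed (merge_atoms (subdomain F (tl x y Y1))) (base_triangle x).
  have /andP[hm hs] := check_similar1; rewrite -[X in base_triangle X](ev_x x y).
  by apply: (similar_merged hxy h1 (models_base hxy _) hm hs); rewrite mem_head.
have sim2 : similar_dressed (merge_atoms (subdomain F (tl x y Y2))) (base_triangle y).
  have /andP[hm hs] := check_similar2; rewrite -[X in base_triangle X](ev_y x y).
  by apply: (similar_merged hxy h2 (models_base hxy _) hm hs); rewrite !inE eqxx orbT.
have sim3 : similar_dressed (merge_atoms (subdomain F (tl x y Y3)))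
    (base_triangle (omega ^+ 4 * alpha * (s - beta ^+ 2))).
  have /andP[hm hs] := check_similar3; rewrite -ex3.
  by apply: (similar_merged hxy h3 (models_base hxy _) hm hs); rewrite !inE eqxx !orbT.
have [/andP[x0 x1] /andP[y0 y1]] := hxy.
have b20 : 0 < beta ^+ 2 :> R by rewrite exprn_gt0 ?beta_gt0.
have b21 : beta ^+ 2 < 1 :> R by rewrite expr_lt1 ?beta_lt1// ltW ?beta_gt0.
have Qunit n : in_Qsqrt5 (omega ^+ n * alpha : R).
  by apply: QsM; [exact/QsX/Qs_omega|exact: Qs_alpha].
have unit0 n : omega ^+ n * alpha != 0 :> R.
  by rewrite mulf_neq0 ?expf_neq0 ?lt0r_neq0 ?omega_gt0 ?alpha_gt0.
have Qt : in_Qsqrt5 y <-> in_Qsqrt5 t.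
  by split=> [|h]; [exact: Qs_mul_cancel|exact: QsM].
have Qsn n : in_Qsqrt5 (omega ^+ n * alpha * (s - beta ^+ 2)) <-> in_Qsqrt5 s.
  have Qb : in_Qsqrt5 (beta ^+ 2 : R) by exact/QsX/Qs_beta.
  split=> [/(Qs_mul_cancel (Qunit n) (unit0 n)) h|h]; last by apply: QsM => //; exact: QsB.
  by rewrite -(subrK (beta ^+ 2) s); exact: QsD.
have x01 : 0 < x < 1 by rewrite x0 x1.
have y01 : 0 < y < 1 by rewrite y1 andbT (lt_trans _ y0)// mulr_gt0.
have z01 : 0 < omega ^+ 4 * alpha * (s - beta ^+ 2) < 1.
  by rewrite -ex3 ev_scale ev_x wRbe2 mulr_gt0//= mulr_ilt1// ltW.
have ss1 := iff_trans (self_similarP x01 sim1) (Qsn 6%N).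
have ss2 := iff_trans (self_similarP y01 sim2) Qt.
have ss3 := iff_trans (self_similarP z01 sim3) (Qsn 4%N).
split; first exact: (models_dressed hxy hF check_dressed_F).
split; first exact: (tiled_by_orbitsP hxy hR check_tiling_R1).
exists (tl x y Y1), (tl x y Y2), (tl x y Y3); split.
- split; first exact: (polygonbP hxy check_triangle_Y1).
    exact: (polygonbP hxy check_triangle_Y2).
  exact: (polygonbP hxy check_triangle_Y3).
- split; first exact: (includedP hxy check_subset_Y1).
    exact: (includedP hxy check_subset_Y2).
  exact: (includedP hxy check_subset_Y3).
- split; first exact: (models_dressed hxy h1 check_dressed_Y1).
    exact: (models_dressed hxy h2 check_dressed_Y2).
  exact: (models_dressed hxy h3 check_dressed_Y3).
- exists [seq tl x y wP.2 | wP <- periodic_tiles]; split=> //.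
    move=> j hj; exists (size (nth ([::], [::]) periodic_tiles j).1).
    rewrite (nth_map ([::], [::]))//.
    exact: (periodicP hxy hF (per_periodic check_tiling_F hj)).
  exact: (tiled_by_orbitsP hxy hF check_tiling_F).
- split=> //; split=> //; split=> [[k1 k2 k3]|[_ [k1 k2]]].
    by split=> //; split; [exact/ss1|exact/ss2].
  by split; [exact/ss1|exact/ss2|exact/ss3].
Qed.
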